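(* Let $\Pi_1,\Pi_2,\Pi_3$ be planar networks of rank $n$ such that each $\Pi_i$ has an $n$-multipath, and let $w_i\in\mathbb T^{\Pi_i}$, $i=1,2,3$. Then the values $m_{i,j,k}=m_{i,j,k}(w_1,w_2,w_3)$ satisfy the tropical tetrahedron equalities: for all integers $i,j,k\ge0$ with $i+j+k\le n-2$, they lie in the non-smooth locus of $$\max\{m_{i,j,k+1}+m_{i+1,j+1,k},\ m_{i,j+1,k}+m_{i+1,j,k+1},\ m_{i+1,j,k}+m_{i,j+1,k+1}\},$$ i.e. the maximum is attained by at least two of the three expressions (equivalently, each of the three expressions is at most the maximum of the other two).
   Context: **Planar networks.** $\mathbb T=\mathbb R\cup\{-\infty\}$. A planar network of rank $n$ is a finite planar graph embedded in a strip $0\le x\le r$ with no vertical edges, oriented from left to right, with $n$ sources on $x=0$ and $n$ sinks on $x=r$, each labelled $1,\dots,n$ from bottom to top. A weighting is a map $w$ from edges to $\mathbb T$; $\mathbb T^\Pi$ is the set of weightings. Concatenation $\Pi_1\circ\Pi_2$ glues the $i$-th sink of $\Pi_1$ to the $i$-th source of $\Pi_2$. An $a$-multipath in $\Pi$ is a collection of $a$ pairwise vertex-disjoint oriented paths from sources to sinks. For $\underline\alpha=(\alpha_1,\alpha_2,\alpha_3)\in\mathbb Z_{\ge0}^3$, an $\underline\alpha$-multipath in $\Pi_1\circ\Pi_2\circ\Pi_3$ is a triple $(p_1,p_2,p_3)$ of pairwise vertex-disjoint multipaths, $p_i$ being an $\alpha_i$-multipath in $\Pi_1\circ\dots\circ\Pi_i$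 (starting at sources of $\Pi_1$ and ending at sinks of $\Pi_i$). Its weight is the sum of the weights of all its edges. **The function $m$.** For $\underline\alpha\in\mathbb Z_{\ge0}^3$ with $\alpha_1+\alpha_2+\alpha_3\le n$, $m_{\underline\alpha}(w_1,w_2,w_3)$ is the maximal weight of an $\underline\alpha$-multipath in $\Pi_1\circ\Pi_2\circ\Pi_3$ ($-\infty$ if there is none), with $m_{0,0,0}=0$. *)

(* Defs.v *)
From HB Require Import structures.
From mathcomp Require Import all_boot all_order all_algebra.
From mathcomp Require Import all_classical all_reals all_analysis.

Set Implicit Arguments.
Unset Strict Implicit.
Unset Printing Implicit Defensive.

Import Order.TTheory GRing.Theory Num.Theory.
Import numFieldNormedType.Exports.

Local Open Scope ring_scope.

Record network (n : nat) := Network {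
  vertex : finType;
  edge : finType;
  etail : edge -> vertex;
  ehead : edge -> vertex;
  source : 'I_n -> vertex;
  sink : 'I_n -> vertex
}.

Definition endpoints n (N : network n) (e : edge N) : {set vertex N} :=
  [set etail e; ehead e].

(* The vertex v is drawn at (xpos v, ypos v). "No vertical edges, oriented from
   left to right" means that x increases along an edge, so the edge e is the
   graph of a continuous function [curve e] over [xpos (etail e), xpos (ehead e)];
   the values of [curve e] elsewhere are irrelevant. Straight segments are the
   case where [curve e] is affine. *)
Record planar_network (R : realType) (n : nat) := PlanarNetwork {
  pn_network :> network n;
  width : R;
  xpos : vertex pn_network -> R;
  ypos : vertex pn_network -> R;
  curve : edge pn_network -> R -> R;
  width_gt0 : 0 < width;
  xpos_strip : forall v, 0 <= xpos v <= width;
  pos_inj : injective (fun v => (xpos v, ypos v));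
  left_to_right : forall e, xpos (etail e) < xpos (ehead e);
  curve_continuous : forall e,
    ({within `[xpos (etail e), xpos (ehead e)], continuous (curve e)})%classic;
  curve_tail : forall e, curve e (xpos (etail e)) = ypos (etail e);
  curve_head : forall e, curve e (xpos (ehead e)) = ypos (ehead e);
  vertex_on_curve : forall e v,
    xpos (etail e) <= xpos v <= xpos (ehead e) ->
    curve e (xpos v) = ypos v -> v \in endpoints e;
  curves_disjoint : forall e f t, e != f ->
    xpos (etail e) <= t <= xpos (ehead e) ->
    xpos (etail f) <= t <= xpos (ehead f) ->
    curve e t = curve f t ->
    exists2 v, v \in endpoints e :&: endpoints f & xpos v = t;
  sourcesE : forall v, xpos v = 0 <-> exists i, source pn_network i = v;
  sinksE : forall v, xpos v = width <-> exists i, sink pn_network i = v;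
  sources_increasing : forall i j : 'I_n, (i < j)%N ->
    ypos (source pn_network i) < ypos (source pn_network j);
  sinks_increasing : forall i j : 'I_n, (i < j)%N ->
    ypos (sink pn_network i) < ypos (sink pn_network j)
}.

Section Concatenation.
Variables (n : nat) (N1 N2 : network n).

(* The sources of N2 are dropped: the i-th one is identified with the i-th sink
   of N1. *)
Definition concat_vertex : finType :=
  (vertex N1 + {v : vertex N2 | v \notin codom (source N2)})%type.

Definition inr_vertex (v : vertex N2) : concat_vertex :=
  match boolP (v \in codom (source N2)) with
  | AltTrue v_source => inl (sink N1 (iinv v_source))
  | AltFalse v_inner => inr (exist _ v v_inner)
  end.

Definition concat : network n :=
  @Network n concat_vertex (edge N1 + edge N2)%type
    (fun e => match e with
              | inl e1 => inl (etail e1)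
              | inr e2 => inr_vertex (etail e2)
              end)
    (fun e => match e with
              | inl e1 => inl (ehead e1)
              | inr e2 => inr_vertex (ehead e2)
              end)
    (fun i => inl (source N1 i))
    (fun i => inr_vertex (sink N2 i)).

Definition inl_vertex (v : vertex N1) : vertex concat := inl v.

End Concatenation.

Section Multipaths.
Variables (n : nat) (N : network n).

(* A path is its sequence of edges. The networks considered here are acyclic,
   so no path has more than #|edge N| edges. *)
Definition edge_seq : finType := #|edge N|.-bseq (edge N).

Definition is_path (p : edge_seq) : bool :=
  if val p is e :: q then
    [&& etail e \in codom (source N),
        path (fun e1 e2 => ehead e1 == etail e2) e q
      & ehead (last e q) \in codom (sink N)]
  else false.

Definition path_vertices (p : edge_seq) : {set vertex N} :=
  \bigcup_(e <- val p) endpoints e.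

Definition multipath (a : nat) (P : {set edge_seq}) : bool :=
  [&& #|P| == a,
      [forall p in P, is_path p]
    & [forall p in P, forall q in P,
         (p != q) ==> [disjoint path_vertices p & path_vertices q]]].

Definition multipath_vertices (P : {set edge_seq}) : {set vertex N} :=
  \bigcup_(p in P) path_vertices p.

End Multipaths.

Definition has_multipath n (N : network n) (a : nat) : Prop :=
  exists P : {set edge_seq N}, multipath a P.

(* Weights are tropical, i.e. in R U {-oo}: among the extended reals only +oo is
   excluded. *)
Definition weighting (R : realType) n (N : network n) (w : edge N -> \bar R) :
  Prop := forall e, w e != +oo%E.

Definition concat_weight (R : realType) n (N1 N2 : network n)
    (w1 : edge N1 -> \bar R) (w2 : edge N2 -> \bar R)
    (e : edge (concat N1 N2)) : \bar R :=
  match e with inl e1 => w1 e1 | inr e2 => w2 e2 end.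

Definition multipath_weight (R : realType) n (N : network n)
    (w : edge N -> \bar R) (P : {set edge_seq N}) : \bar R :=
  (\sum_(p in P) \sum_(e <- val p) w e)%E.

Section TripleMultipaths.
Variables (n : nat) (N1 N2 N3 : network n).

Local Notation N12 := (concat N1 N2).
Local Notation N123 := (concat N12 N3).

Definition triple : finType :=
  ({set edge_seq N1} * {set edge_seq N12} * {set edge_seq N123})%type.

(* Disjointness is tested in the full network, into which the vertices of N1
   and of N12 are injected. *)
Definition alpha_multipath (a1 a2 a3 : nat) (P : triple) : bool :=
  let: (P1, P2, P3) := P in
  let V1 : {set vertex N123} :=
    [set inl_vertex N3 (inl_vertex N2 v) | v : vertex N1 in multipath_vertices P1] in
  let V2 : {set vertex N123} :=
    [set inl_vertex N3 v | v : vertex N12 in multipath_vertices P2] in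
  let V3 : {set vertex N123} := multipath_vertices P3 in
  [&& multipath a1 P1, multipath a2 P2, multipath a3 P3,
      [disjoint V1 & V2], [disjoint V1 & V3] & [disjoint V2 & V3]].

Variable R : realType.
Variables (w1 : edge N1 -> \bar R) (w2 : edge N2 -> \bar R)
  (w3 : edge N3 -> \bar R).

Local Notation w12 := (concat_weight w1 w2).
Local Notation w123 := (concat_weight w12 w3).

Definition triple_weight (P : triple) : \bar R :=
  let: (P1, P2, P3) := P in
  (multipath_weight w1 P1 + multipath_weight w12 P2
    + multipath_weight w123 P3)%E.

(* The maximum over the empty set is -oo. For a1 = a2 = a3 = 0 the only
   competitor is the triple of empty multipaths, of weight 0. *)
Definition max_weight (a1 a2 a3 : nat) : \bar R :=
  \big[maxe/-oo%E]_(P : triple | alpha_multipath a1 a2 a3 P) triple_weight P.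

End TripleMultipaths.

Definition max_attained_twice (R : realType) (x y z : \bar R) : Prop :=
  let M := maxe x (maxe y z) in
  [\/ x = M /\ y = M, x = M /\ z = M | y = M /\ z = M].

(* Main.v *)
(** The statement is an exchange property of valuated
    matroids. Encode a triple of multipaths by the incoming edge chosen at each
    visited vertex, i.e. by a matching between right-hand and left-hand copies of
    the vertices. The unmatched left-hand copies are the unused sources (class 0)
    and the endpoints of the paths, which have class s if they are sinks of the
    s-th factor. The symmetric difference of two such matchings g and f consists
    of trails, and each trail from a vertex free for g only ends at a vertex free
    for f only, and may be swapped independently of the others. If g has type
    a + e_x and f has type a + e_y + e_z, then in the graph on the four classes
    whose arcs are the trails, 0 and x have one more outgoing than incoming arc,
    while y and z have one less. Hence a path of trails leads from x to q = y or
    q = z, and swapping it yields types a + e_q and a + e_x + e_y + e_z - e_q with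
    the same total weight. *)
Require Import Defs.
From mathcomp Require Import all_boot all_order all_algebra.
From mathcomp Require Import all_classical all_reals all_analysis.
From mathcomp Require Import zify.
(* Restores the finite-set lemmas shadowed by classical_sets. *)
From mathcomp Require Import fintype finset.

Set Implicit Arguments.
Unset Strict Implicit.
Unset Printing Implicit Defensive.

(** * Flows and their exchanges *)

Section Flows.
Variables (V E : finType) (t h : E -> V) (cls : V -> nat).

(* The incoming edge of each vertex, [None] at sources and unvisited vertices.
   [link] is then the identity at unvisited vertices, which are thereby matched
   with themselves. *)
Definition flow_map := {ffun V -> option E}.

Definition link g v := if g v is Some e then t e else v.
Definition inner : {set V} := [set v | cls v != 0].
Definition free g : {set V} := ~: (link g @: inner).

(** The second clause makes the chosen edges a matching of the right-hand copies in [inner]. The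
    third lets paths end only at vertices of class at most 3. *)
Definition is_flow g : Prop :=
  [/\ forall v e, g v = Some e -> h e = v,
      {in inner &, injective (link g)}
    & forall v, v \in free g -> cls v <= 3].

Definition swap (D : {set V}) g f : flow_map :=
  [ffun v => if v \in D then f v else g v].

Lemma link_swap D g f v :
  link (swap D g f) v = if v \in D then link f v else link g v.
Proof. by rewrite /link ffunE; case: ifP. Qed.

Lemma freePn g v :
  reflect (exists2 r, r \in inner & v = link g r) (v \notin free g).
Proof. by rewrite inE negbK; apply: (iffP imsetP). Qed.

Lemma link_notin_free g r : r \in inner -> link g r \notin free g.
Proof. by move=> ri; apply/freePn; exists r. Qed.

(** Two links both taken in [D], or both outside it, stay distinct. The only possible collision is
    between an [f]-link from [D] and a [g]-link from outside, which the closure of [D] forbids. *)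
Lemma swap_flow (D : {set V}) g f :
  is_flow g -> is_flow f ->
  {in inner &, forall r s, r \in D -> link f r = link g s -> s \in D} ->
  (forall v, v \in free (swap D g f) -> cls v <= 3) -> is_flow (swap D g f).
Proof.
move=> [gh gI _] [fh fI _] DP fr; split=> //.
  by move=> v e; rewrite ffunE; case: ifP => _; [apply: fh | apply: gh].
move=> r s ri si; rewrite !link_swap.
case: ifP => rD; case: ifP => sD.
- exact: fI.
- by move=> /DP -/(_ ri si rD); rewrite sD.
- by move=> /esym /DP -/(_ si ri sD); rewrite rD.
- exact: gI.
Qed.

Definition class_count (A : {set V}) s := #|[set v in A | cls v == s]|.

Lemma class_countD (A S : {set V}) s :
  S \subset A -> class_count (A :\: S) s + class_count S s = class_count A s.
Proof.
move=> SA; rewrite addnC /class_count -cardsUI.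
have -> : [set v in S | cls v == s] :&: [set v in A :\: S | cls v == s] = set0.
  by apply/setP => v; rewrite !inE; case: (v \in S); rewrite ?andbF.
rewrite cards0 addn0; congr #|pred_of_set _|; apply/setP => v; rewrite !inE.
by have := subsetP SA v; case: (v \in S) => //= /(_ isT) ->; rewrite orbF.
Qed.

Lemma class_countU (A T : {set V}) s :
  [disjoint A & T] -> class_count (A :|: T) s = class_count A s + class_count T s.
Proof.
move=> AT; rewrite /class_count -cardsUI.
have -> : [set v in A | cls v == s] :&: [set v in T | cls v == s] = set0.
  apply/setP => v; rewrite !inE; apply/negP => /andP[/andP[vA _] /andP[vT _]].
  by have := disjointFr AT vA; rewrite vT.
rewrite cards0 addn0; congr #|pred_of_set _|.
by apply/setP => v; rewrite !inE andb_orl.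
Qed.

Lemma class_count1 u s : class_count [set u] s = (cls u == s).
Proof.
rewrite /class_count; case: eqP => [<-|us].
  rewrite -[RHS](cards1 u); congr #|pred_of_set _|.
  by apply/setP => v; rewrite !inE; case: eqP => // ->; rewrite eqxx.
apply/eqP; rewrite cards_eq0; apply/eqP/setP => v; rewrite !inE.
by case: eqP => // -> ; apply/eqP.
Qed.

(** Both sides count the union of [A] and [B]. *)
Lemma class_count_diff (A B : {set V}) s :
  class_count (A :\: B) s + class_count B s = class_count (B :\: A) s + class_count A s.
Proof.
have := @class_countD A (A :&: B) s (subsetIl _ _).
have := @class_countD B (A :&: B) s (subsetIr _ _).
by rewrite !setDIr !setDv set0U setU0; lia.
Qed.

(** * Swapping trails between two flows *)

Section Exchange.
Variables g f : flow_map.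
Hypotheses (g_flow : is_flow g) (f_flow : is_flow f).

Let g_inj : {in inner &, injective (link g)}. Proof. by case: g_flow. Qed.
Let f_inj : {in inner &, injective (link f)}. Proof. by case: f_flow. Qed.

(** From the right-hand copy [r] the matching [g] leads to a left-hand copy, and [f] leads back from
    it to [s]. *)
Definition step : rel V :=
  fun r s => [&& r \in inner, s \in inner & link g r == link f s].

(* The trails that leave the vertices of [S] along [f] and return along [g],
   each represented by the vertices whose incoming edges it uses. *)
Definition trails (S : {set V}) : {set V} :=
  [set r | [exists s in inner, (link f s \in S) && connect step s r]].

Definition trail_ends (S : {set V}) := (link g @: trails S) :&: free f.

Lemma trailsP (S : {set V}) r :
  reflect (exists s, [/\ s \in inner, link f s \in S & connect step s r])
          (r \in trails S).
Proof.
rewrite inE; apply: (iffP exists_inP) => [[s si /andP[sS c]]|[s [si sS c]]].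
  by exists s.
by exists s; rewrite ?sS.
Qed.

Lemma trailsU S T : trails (S :|: T) = trails S :|: trails T.
Proof.
apply/setP => r; rewrite in_setU; apply/trailsP/orP.
  case=> s [si]; rewrite in_setU => /orP[] sS c; [left|right];
  by apply/trailsP; exists s.
by case=> /trailsP [s [si sS c]]; exists s; rewrite in_setU sS ?orbT.
Qed.

Lemma trail_endsU S T : trail_ends (S :|: T) = trail_ends S :|: trail_ends T.
Proof. by rewrite /trail_ends trailsU imsetU setIUl. Qed.

Lemma trail_ends_pick S v :
  v \in trail_ends S -> exists2 u, u \in S & v \in trail_ends [set u].
Proof.
rewrite in_setI => /andP[/imsetP[r /trailsP[s [si sS c]] ->] vf].
exists (link f s) => //; rewrite in_setI vf andbT imset_f //.
by apply/trailsP; exists s; rewrite set11.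
Qed.

Lemma trails_inner S : {subset trails S <= inner}.
Proof.
move=> r /trailsP[s [si _ /connectP[p pp ->]]].
elim/last_ind: p pp => [//|p x _]; rewrite rcons_path last_rcons.
by case/andP=> _ /and3P[].
Qed.

Lemma trails_forward S : {in inner &, forall r s,
  r \in trails S -> link g r = link f s -> s \in trails S}.
Proof.
move=> r s ri si /trailsP[q [qi qS c]] e; apply/trailsP; exists q; split=> //.
by apply: connect_trans c (connect1 _); apply/and3P; rewrite e eqxx.
Qed.

Lemma trails_start (S : {set V}) r :
  r \in inner -> link f r \in S -> r \in trails S.
Proof. by move=> ri rS; apply/trailsP; exists r; rewrite connect0. Qed.

Lemma trails_pred (S : {set V}) s :
  s \in trails S -> link f s \notin S ->
  exists2 r, r \in trails S & link g r = link f s.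
Proof.
case/trailsP=> q [qi qS /connectP[p]].
elim/last_ind: p => [_ /= -> /negP //|p x _].
rewrite rcons_path last_rcons => /andP[pp /and3P[_ _ /eqP st]] -> _.
exists (last q p) => //; apply/trailsP; exists q; split=> //.
by apply/connectP; exists p.
Qed.

(** A trail can be followed back until it reaches [S], and the vertices of [S], being free for [g],
    have no predecessor. *)
Lemma trails_backward (S : {set V}) : S \subset free g ->
  {in inner &, forall r s,
    r \in trails S -> link f r = link g s -> s \in trails S}.
Proof.
move=> Sg r s ri si rD e; have [rS|rS] := boolP (link f r \in S).
  by have := link_notin_free g si; rewrite -e (subsetP Sg).
have [q qD eq] := trails_pred rD rS.
by rewrite -(g_inj (trails_inner qD) si) // eq.
Qed.

(** Both links are injective on the trails. The tails along [g] are those along [f] with [S] removed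
    and the trail ends added, so as many vertices are added as removed. *)
Lemma card_trail_ends (S : {set V}) :
  S \subset free g :\: free f -> #|trail_ends S| = #|S|.
Proof.
move=> SX; set D := trails S.
have cg : #|link g @: D| = #|D|.
  by apply: card_in_imset => a b /trails_inner ai /trails_inner bi; apply: g_inj.
have cf : #|link f @: D| = #|D|.
  by apply: card_in_imset => a b /trails_inner ai /trails_inner bi; apply: f_inj.
have Sf : S \subset link f @: D.
  apply/subsetP => u uS; have /setDP[_ /freePn[r ri ur]] := subsetP SX _ uS.
  by rewrite ur imset_f // trails_start // -ur.
have TE : trail_ends S = link g @: D :\: (link f @: D :\: S).
  apply/setP => v; rewrite in_setI !in_setD andbC.
  have [|] := boolP (v \in link g @: D); rewrite ?andbF // => /imsetP[r rD ->].
  rewrite !andbT; have ri := trails_inner rD.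
  have -> : (link g r \in S) = false.
    apply: contraTF (link_notin_free g ri) => /(subsetP SX).
    by rewrite negbK => /setDP[].
  apply/idP/idP; apply: contraTT; rewrite negbK.
    by case/imsetP => s sD ->; apply/link_notin_free/trails_inner/sD.
  by case/freePn => s si e; rewrite e imset_f // (trails_forward ri si).
have sub : link f @: D :\: S \subset link g @: D.
  apply/subsetP => v /setDP[/imsetP[s sD ->] sS].
  by have [r rD <-] := trails_pred sD sS; apply: imset_f.
rewrite TE cardsD (setIidPr sub) cg cardsD (setIidPr Sf) cf subKn //.
by rewrite -cf subset_leq_card.
Qed.

Lemma trail_ends_sub (S : {set V}) : trail_ends S \subset free f :\: free g.
Proof.
apply/subsetP => v; rewrite in_setI in_setD => /andP[/imsetP[r rD ->] ->].
by rewrite andbT link_notin_free // (trails_inner rD).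
Qed.

Lemma in_free_swap (D : {set V}) (g1 f1 : flow_map) v :
  {subset D <= inner} -> {in inner &, injective (link g1)} ->
  (v \in free (swap D g1 f1)) =
  (v \notin link f1 @: D) && ((v \in free g1) || (v \in link g1 @: D)).
Proof.
move=> Di g1I; apply: negb_inj; rewrite negb_and negb_or negbK in_setC negbK.
apply/imsetP/orP.
  case=> r ri; rewrite link_swap; case: ifP => rD ->.
    by left; apply: imset_f.
  right; apply/andP; split; first exact: link_notin_free.
  by apply/imsetP => -[s sD e]; move: rD; rewrite (g1I r s ri (Di s sD) e) sD.
case.
  by case/imsetP=> s sD ->; exists s; rewrite ?Di // link_swap sD.
case/andP=> /freePn[s si ->] nA; exists s => //; rewrite link_swap ifN //.
by apply: contra nA => sD; apply: imset_f.
Qed.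

(** Intermediate left-hand copies of a trail are matched by both flows and stay matched after the
    swap; only the starts in [S] and the trail ends change status. *)
Lemma exchange (S : {set V}) : S \subset free g :\: free f ->
  [/\ is_flow (swap (trails S) g f), is_flow (swap (trails S) f g),
      free (swap (trails S) g f) = free g :\: S :|: trail_ends S
    & free (swap (trails S) f g) = free f :\: trail_ends S :|: S].
Proof.
move=> SX; set D := trails S.
have [Sg Sf] : S \subset free g /\ [disjoint S & free f].
  by move: SX; rewrite subsetD => /andP[].
have [_ _ gc] := g_flow; have [_ _ fc] := f_flow.
have Di : {subset D <= inner} := @trails_inner S.
have fD v : v \in S -> v \in link f @: D.
  move=> vS; have /setDP[_ /freePn[r ri vr]] := subsetP SX _ vS.
  by rewrite vr imset_f // trails_start // -vr.
have gD v : v \in S -> v \notin link g @: D.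
  move=> vS; apply/imsetP => -[r rD e].
  by have := link_notin_free g (Di _ rD); rewrite -e (subsetP Sg).
have fDg v : v \in link f @: D -> v \notin S -> v \in link g @: D.
  case/imsetP => s sD -> sS.
  by have [r rD <-] := trails_pred sD sS; apply: imset_f.
have gDf v : v \in link g @: D -> v \notin free f -> v \in link f @: D.
  case/imsetP => r rD -> /freePn[s si e]; rewrite e.
  by rewrite imset_f // (trails_forward (Di _ rD) si).
have fDn v : v \in link f @: D -> v \notin free f.
  by case/imsetP => s sD ->; apply/link_notin_free/Di.
have gDn v : v \in link g @: D -> v \notin free g.
  by case/imsetP => s sD ->; apply/link_notin_free/Di.
have E1 : free (swap D g f) = free g :\: S :|: trail_ends S.
  apply/setP => v; rewrite in_free_swap // in_setU in_setD in_setI -/D.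
  (* Given these six facts, the membership of [v] is a propositional matter. *)
  move: (fD v) (gD v) (fDg v) (gDf v) (fDn v) (gDn v).
  lia.
have E2 : free (swap D f g) = free f :\: trail_ends S :|: S.
  apply/setP => v; rewrite in_free_swap // in_setU in_setD in_setI -/D.
  move: (fD v) (gD v) (fDg v) (gDf v) (fDn v) (gDn v).
  lia.
split=> //; apply: swap_flow => //.
- exact: trails_backward.
- move=> v; rewrite E1 in_setU in_setD in_setI => /orP[/andP[_ /gc]|/andP[_ /fc]] //.
- exact: trails_forward.
- move=> v; rewrite E2 in_setU in_setD => /orP[/andP[_ /fc]|/(subsetP Sg)/gc] //.
Qed.

End Exchange.

(** * Choosing the trails by the classes of their ends *)

Section ExchangeClasses.
Variables (g f : flow_map) (x y z : nat).
Hypotheses (g_flow : is_flow g) (f_flow : is_flow f).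
Hypothesis classes : forall s : nat, s <= 3 -> [|| s == 0, s == x, s == y | s == z].
Hypothesis classes_uniq : uniq [:: 0; x; y; z].
Hypothesis excess : forall s : nat,
  class_count (free g) s + (s == y) + (s == z) =
  class_count (free f) s + (s == 0) + (s == x).

Let X := free g :\: free f.

Let trail_end1 u v :
  u \in X -> v \in trail_ends g f [set u] -> trail_ends g f [set u] = [set v].
Proof.
move=> uX vT; have uS : [set u] \subset X by rewrite sub1set.
have /eqP := card_trail_ends g_flow f_flow uS.
by rewrite cards1 => /cards1P[w wT]; move: vT; rewrite wT => /set1P ->.
Qed.

(* The classes form the nodes of a graph whose arcs are the trails. The nodes 0
   and [x] have one more outgoing than incoming arc, so [x] is joined to [y] or
   [z] either directly or through 0. *)
Lemma select_trails : exists (S : {set V}) (q : nat),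
  [/\ S \subset X, (q == y) || (q == z)
    & forall s : nat, class_count (trail_ends g f S) s + (s == x) =
                class_count S s + (s == q)].
Proof.
(* Trails have as many ends as starts. If more starts than possible ends have a class in [P], some
   trail must leave [P]. *)
have pigeon (P : pred nat) :
    #|[set v in free f :\: free g | P (cls v)]| < #|[set u in X | P (cls u)]| ->
    exists u v, [/\ u \in X, P (cls u), ~~ P (cls v), cls v <= 3
                  & trail_ends g f [set u] = [set v]].
  set S := [set u in X | _]; have SX : S \subset X.
    by apply/subsetP => u; rewrite inE => /andP[].
  rewrite -(card_trail_ends g_flow f_flow SX) => ltS.
  have /subsetPn[v vS] : ~~ (trail_ends g f S \subset
                             [set v in free f :\: free g | P (cls v)]).
    by apply: contraL ltS => /subset_leq_card; rewrite -leqNgt.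
  have vY := subsetP (trail_ends_sub g f S) v vS.
  rewrite inE vY /= => vP; have [u uS vu] := trail_ends_pick vS.
  move: uS; rewrite inE => /andP[uX uP].
  exists u, v; split=> //; last exact: trail_end1 uX vu.
  by case: f_flow => _ _; apply; move: vY => /setDP[].
have direct u v : u \in X -> cls u = x -> (cls v == y) || (cls v == z) ->
    trail_ends g f [set u] = [set v] -> exists (S : {set V}) (q : nat),
    [/\ S \subset X, (q == y) || (q == z)
      & forall s : nat, class_count (trail_ends g f S) s + (s == x) =
                class_count S s + (s == q)].
  move=> uX ux vyz e; exists [set u], (cls v); split=> //; first by rewrite sub1set.
  by move=> s; rewrite e !class_count1 ux addnC eq_sym [cls v == s]eq_sym.
have dX (s : nat) : class_count (free f :\: free g) s + (s == 0) + (s == x) =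
            class_count X s + (s == y) + (s == z).
  by have := class_count_diff (free g) (free f) s; have := excess s; rewrite /X; lia.
(* Class [x] alone has one start more than ends. *)
have [u1 [v1 [u1X /eqP u1x v1x /classes v1c e1]]] : exists u v,
    [/\ u \in X, cls u == x, cls v != x, cls v <= 3
      & trail_ends g f [set u] = [set v]].
  apply: (pigeon (pred1 x)).
  by have := dX x; move: classes_uniq; rewrite /class_count /= !inE eqxx; lia.
have [v1yz|v1yz] := boolP ((cls v1 == y) || (cls v1 == z)).
  exact: direct u1X u1x v1yz e1.
have /eqP v10 : cls v1 == 0 by move: v1c v1x v1yz; lia.
have count0x (A : {set V}) :
    #|[set v in A | (cls v == 0) || (cls v == x)]| = class_count A 0 + class_count A x.
  rewrite /class_count -cardsUI addnC.
  have -> : [set v in A | cls v == 0] :&: [set v in A | cls v == x] = set0.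
    by apply/setP => v; rewrite !inE; move: classes_uniq; rewrite /= !inE; lia.
  rewrite cards0; congr #|pred_of_set _|; apply/setP => v; rewrite !inE; lia.
(* The first trail ends in class 0. Classes 0 and [x] together have two starts more than ends, so
   some trail leaves their union; if it starts in class 0, it prolongs the first one in the graph of
   classes. *)
have [u2 [v2 [u2X u2x v2x /classes v2c e2]]] : exists u v,
    [/\ u \in X, (cls u == 0) || (cls u == x), ~~ ((cls v == 0) || (cls v == x)),
        cls v <= 3 & trail_ends g f [set u] = [set v]].
  apply: (pigeon (fun s => (s == 0) || (s == x))); rewrite !count0x.
  by have := dX 0; have := dX x; move: classes_uniq; rewrite /= !inE !eqxx; lia.
have v2yz : (cls v2 == y) || (cls v2 == z) by move: v2c v2x; lia.
have [/eqP u2x'|u2x'] := boolP (cls u2 == x).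
  exact: direct u2X u2x' v2yz e2.
have /eqP u20 : cls u2 == 0 by move: u2x u2x'; lia.
have x0 : x != 0 by move: classes_uniq; rewrite /= !inE; lia.
exists ([set u1] :|: [set u2]), (cls v2); split=> //.
  by rewrite subUset !sub1set u1X.
move=> s; rewrite trail_endsU e1 e2 !class_countU ?class_count1 ?v10 ?u1x ?u20.
- by rewrite [s == x]eq_sym [s == cls v2]eq_sym; lia.
- by rewrite disjoints1 inE; apply: contra x0 => /eqP uu; rewrite -u1x uu u20.
- by rewrite disjoints1 inE; apply: contra v2x => /eqP <-; rewrite v10.
Qed.

End ExchangeClasses.

(** [A] is the part common to both types. The term [(s == q)] stands on the left of the last
    equation to avoid a truncated subtraction. *)
Lemma exchange_classes (g f : flow_map) (A : nat -> nat) (x y z : nat) :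
  is_flow g -> is_flow f ->
  (forall s, s <= 3 -> [|| s == 0, s == x, s == y | s == z]) ->
  uniq [:: 0; x; y; z] ->
  (forall s : nat, class_count (free g) s = A s + (s == 0) + (s == x)) ->
  (forall s : nat, class_count (free f) s = A s + (s == y) + (s == z)) ->
  exists (D : {set V}) (q : nat),
    [/\ is_flow (swap D g f), is_flow (swap D f g), (q == y) || (q == z),
        forall s : nat,
          class_count (free (swap D g f)) s = A s + (s == 0) + (s == q)
      & forall s : nat, class_count (free (swap D f g)) s + (s == q) =
          A s + (s == x) + (s == y) + (s == z)].
Proof.
move=> gF fF all4 u4 cg cf.
have [|S [q [SX qyz cS]]] := select_trails gF fF all4 u4.
  by move=> s; rewrite cg cf; lia.
have [F1 F2 E1 E2] := exchange gF fF SX.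
have TX := trail_ends_sub g f S.
exists (trails g f S), q; split=> // s; [rewrite E1 | rewrite E2];
  rewrite class_countU.
- have /(@class_countD (free g) S s) : S \subset free g.
    by apply: subset_trans SX (subsetDl _ _).
  by have := cS s; have := cg s; lia.
- rewrite -setI_eq0; apply/eqP/setP => v; have := subsetP TX v.
  by rewrite !inE; lia.
- have /(@class_countD (free f) (trail_ends g f S) s) : trail_ends g f S \subset free f.
    by apply: subset_trans TX (subsetDl _ _).
  by have := cS s; have := cf s; lia.
- rewrite -setI_eq0; apply/eqP/setP => v; have := subsetP SX v.
  by rewrite !inE; lia.
Qed.

(** * Flows and families of disjoint paths *)

Section Linkages.
(** A rank that grows along edges expresses acyclicity and serves as induction measure. *)
Variable rk : V -> nat.
Hypothesis rk_lt : forall e, rk (t e) < rk (h e).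
Hypothesis cls_head : forall e, cls (h e) != 0.

Definition follows : rel E := fun e1 e2 => h e1 == t e2.

Definition linked_path (s : nat) (p : seq E) : bool :=
  if p is e :: q then
    [&& cls (t e) == 0, path follows e q & cls (h (last e q)) == s]
  else false.

Definition path_end (p : seq E) : option V :=
  if p is e :: q then Some (h (last e q)) else None.

Definition vertices (p : seq E) : {set V} := \bigcup_(e <- p) [set t e; h e].

Lemma verticesP (p : seq E) v :
  reflect (exists2 e, e \in p & (v == t e) || (v == h e)) (v \in vertices p).
Proof.
rewrite /vertices; elim: p => [|e p IH].
  by rewrite big_nil inE; constructor; case.
rewrite big_cons in_setU !inE; apply: (iffP orP).
  case=> [ev|/IH[f fp fv]]; first by exists e; rewrite ?mem_head.
  by exists f; rewrite // inE fp orbT.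
case=> f; rewrite inE => /orP[/eqP ->|fp fv]; first by left.
by right; apply/IH; exists f.
Qed.

Lemma tail_vertices (p : seq E) e : e \in p -> t e \in vertices p.
Proof. by move=> ep; apply/verticesP; exists e; rewrite ?eqxx. Qed.

Lemma head_vertices (p : seq E) e : e \in p -> h e \in vertices p.
Proof. by move=> ep; apply/verticesP; exists e; rewrite ?eqxx ?orbT. Qed.

Lemma path_pred e q f : path follows e q -> f \in e :: q ->
  f = e \/ exists2 f', f' \in e :: q & h f' = t f.
Proof.
elim: q e => [|e' q IH] e /=; first by move=> _ /[!inE] /eqP; left.
case/andP=> /eqP he pq; rewrite inE => /orP[/eqP ->|/(IH _ pq)]; first by left.
case=> [->|[f' f'q e1]]; right; first by exists e; rewrite ?mem_head.
by exists f'; rewrite // inE f'q orbT.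
Qed.

Lemma path_succ e q f : path follows e q -> f \in e :: q ->
  f = last e q \/ exists2 f', f' \in e :: q & t f' = h f.
Proof.
elim: q e => [|e' q IH] e /=; first by move=> _ /[!inE] /eqP; left.
case/andP=> /eqP he pq; rewrite inE => /orP[/eqP ->|/(IH _ pq)].
  by right; exists e'; rewrite ?he // !inE eqxx orbT.
case=> [->|[f' f'q e1]]; [by left | right].
by exists f'; rewrite // inE f'q orbT.
Qed.

Lemma path_rk_last e q f :
  path follows e q -> f \in e :: q -> rk (h f) <= rk (h (last e q)).
Proof.
elim: q e f => [|e' q IH] e f /=; first by move=> _ /[!inE] /eqP ->.
case/andP=> /eqP he pq; rewrite inE => /orP[/eqP ->|/(IH _ _ pq) //].
by apply: leq_trans _ (IH _ _ pq (mem_head _ _)); rewrite he ltnW.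
Qed.

Lemma path_sorted_rk e q :
  path follows e q ->
  sorted (relpre (rk \o h) ltn) (e :: q) /\ sorted (relpre (rk \o t) ltn) (e :: q).
Proof.
move=> pq; split; apply: sub_path pq => a b /eqP ab /=; first by rewrite ab.
by rewrite -ab.
Qed.

Lemma linked_path_uniq s p : linked_path s p -> uniq p.
Proof.
case: p => // e q /and3P[_ /path_sorted_rk[pq _] _].
by apply: (sorted_uniq _ _ pq) => [x y z|x]; [apply: ltn_trans | apply: ltnn].
Qed.

(** Paths repeat no edge, so each of them fits into the bounded sequences [epath]. *)
Lemma linked_path_size s p : linked_path s p -> size p <= #|E|.
Proof. by move=> /linked_path_uniq /card_uniqP <-; apply: max_card. Qed.

Lemma sorted_inj (k : E -> nat) (p : seq E) :
  sorted (relpre k ltn) p -> {in p &, injective k}.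
Proof.
elim: p => // c p IH cp a b.
have ktr : transitive (relpre k ltn) by move=> ? ? ?; apply: ltn_trans.
have /allP cmin := order_path_min ktr cp.
rewrite !inE => /orP[/eqP ->|ap] /orP[/eqP ->|bp] // kab.
- by have := cmin _ bp; rewrite /= kab ltnn.
- by have := cmin _ ap; rewrite /= kab ltnn.
- by apply: IH kab => //; apply: path_sorted cp.
Qed.

Lemma linked_path_head_inj s p : linked_path s p -> {in p &, injective h}.
Proof.
case: p => // e q /and3P[_ /path_sorted_rk[/sorted_inj I _] _] a b ap bp ab.
by apply: I => //=; rewrite ab.
Qed.

Lemma linked_path_tail_inj s p : linked_path s p -> {in p &, injective t}.
Proof.
case: p => // e q /and3P[_ /path_sorted_rk[_ /sorted_inj I] _] a b ap bp ab.
by apply: I => //=; rewrite ab.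
Qed.

Lemma linked_path_class s s' p : linked_path s p -> linked_path s' p -> s = s'.
Proof. by case: p => // e q /and3P[_ _ /eqP <-] /and3P[_ _ /eqP]. Qed.

Local Notation epath := (#|E|.-bseq E).

(** One set holds the paths of all three kinds; the class of its last vertex tells to which
    multipath a path belongs. *)
Definition linkage (Q : {set epath}) : Prop :=
  (forall p, p \in Q -> exists2 s, 0 < s <= 3 & linked_path s p) /\
  {in Q &, forall p q : epath, p != q -> [disjoint vertices p & vertices q]}.

Definition linkage_count (Q : {set epath}) s := #|[set p in Q | linked_path s p]|.

Definition linkage_edges (Q : {set epath}) : {set E} :=
  [set e | [exists p in Q, e \in bseqval p]].

Lemma linkage_edgesP (Q : {set epath}) e :
  reflect (exists2 p, p \in Q & e \in bseqval p) (e \in linkage_edges Q).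
Proof. by rewrite inE; apply: exists_inP. Qed.

(** * From disjoint paths to flows *)

Section LinkageToFlow.
Variable Q : {set epath}.
Hypothesis Q_linkage : linkage Q.

Lemma linkage_vertex p q v :
  p \in Q -> q \in Q -> v \in vertices p -> v \in vertices q -> p = q.
Proof.
move=> pQ qQ vp vq; apply/eqP; apply: contraT => pq.
by have := disjointFr (Q_linkage.2 _ _ pQ qQ pq) vp; rewrite vq.
Qed.

Lemma linkage_head_inj : {in linkage_edges Q &, injective h}.
Proof.
move=> e f /linkage_edgesP[p pQ ep] /linkage_edgesP[q qQ fq] ef.
have pq : p = q.
  by apply: (@linkage_vertex p q (h e)) => //; [|rewrite ef]; apply: head_vertices.
have [s _ ps] := Q_linkage.1 _ pQ.
by apply: (linked_path_head_inj ps) => //; rewrite pq.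
Qed.

Lemma linkage_tail_inj : {in linkage_edges Q &, injective t}.
Proof.
move=> e f /linkage_edgesP[p pQ ep] /linkage_edgesP[q qQ fq] ef.
have pq : p = q.
  by apply: (@linkage_vertex p q (t e)) => //; [|rewrite ef]; apply: tail_vertices.
have [s _ ps] := Q_linkage.1 _ pQ.
by apply: (linked_path_tail_inj ps) => //; rewrite pq.
Qed.

(** At most one edge qualifies, by [linkage_head_inj], so [pick] makes no arbitrary choice. *)
Definition linkage_flow : flow_map :=
  [ffun v => [pick e | (e \in linkage_edges Q) && (h e == v)]].

Lemma linkage_flowP v e :
  linkage_flow v = Some e <-> e \in linkage_edges Q /\ h e = v.
Proof.
rewrite ffunE; split.
  by case: pickP => // f /andP[fQ /eqP fv] [<-].
case=> eQ <-; case: pickP => [f /andP[fQ /eqP fe]|/(_ e)]; last by rewrite eQ eqxx.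
by congr Some; apply: linkage_head_inj.
Qed.

Lemma linkage_flow_head e : e \in linkage_edges Q -> linkage_flow (h e) = Some e.
Proof. by move=> eQ; apply/linkage_flowP. Qed.

Lemma linkage_flow_link e : e \in linkage_edges Q -> link linkage_flow (h e) = t e.
Proof. by move=> eQ; rewrite /link linkage_flow_head. Qed.

Lemma linkage_edges_pred e : e \in linkage_edges Q -> cls (t e) != 0 ->
  exists2 f, f \in linkage_edges Q & h f = t e.
Proof.
move=> /linkage_edgesP[p pQ ep] te; have [s _] := Q_linkage.1 _ pQ.
case Ep: (bseqval p) ep => [//|a q] ep /and3P[ca paq _].
case: (path_pred paq ep) => [ea|[f fq hf]]; first by rewrite ea (eqP ca) in te.
by exists f => //; apply/linkage_edgesP; exists p; rewrite ?Ep.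
Qed.

Lemma linkage_edges_succ p e : p \in Q -> e \in bseqval p ->
  [/\ path_end p = Some (h e), linked_path (cls (h e)) p & 0 < cls (h e) <= 3] \/
  exists2 f, f \in linkage_edges Q & t f = h e.
Proof.
move=> pQ ep; have [s s3] := Q_linkage.1 _ pQ; rewrite /linked_path /path_end.
case Ep: (bseqval p) ep => [//|a q] ep /and3P[ca paq /eqP ls].
case: (path_succ paq ep) => [->|[f fq tf]].
  by left; rewrite ca paq ls eqxx.
by right; exists f => //; apply/linkage_edgesP; exists p; rewrite ?Ep.
Qed.

(** The end of [p] is visited, hence not matched with itself. An edge of the linkage leaving it
    would lie on [p] by disjointness, and its head would outrank the last vertex of [p]. *)
Lemma linked_path_end s p : p \in Q -> linked_path s p -> 0 < s <= 3 ->
  exists v, [/\ path_end p = Some v, v \in vertices p, cls v = s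
               & v \in free linkage_flow].
Proof.
move=> pQ; rewrite /linked_path /path_end; case Ep: (bseqval p) => [//|a q].
case/and3P=> ca paq /eqP ls s3; have lq := mem_last a q.
exists (h (last a q)); split=> //; first exact: head_vertices.
apply/negPn/freePn => -[v vi].
rewrite /link; case Ev: (linkage_flow v) => [f|] vE; last first.
  have : linkage_flow (h (last a q)) = Some (last a q).
    by apply: linkage_flow_head; apply/linkage_edgesP; exists p; rewrite ?Ep.
  by rewrite vE Ev.
have /linkage_flowP[/linkage_edgesP[p' p'Q fp'] _] := Ev.
have pp' : p = p'.
  apply: (@linkage_vertex p p' (t f)) => //; last exact: tail_vertices.
  by rewrite -vE; apply: head_vertices; rewrite Ep.
move: fp'; rewrite -pp' Ep => /(path_rk_last paq); rewrite vE.
by have := rk_lt f; rewrite ltnNge => /negbTE ->.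
Qed.

(** Used edges have distinct tails, and unvisited vertices are linked to themselves. In the mixed
    case an unvisited [s] would be the tail of a used edge; as its class is not 0, another used edge
    would enter it. *)
Lemma linkage_flow_inj : {in inner &, injective (link linkage_flow)}.
Proof.
have main r s e : r \in inner -> s \in inner -> linkage_flow r = Some e ->
    link linkage_flow r = link linkage_flow s -> r = s.
  move=> ri si re; have /linkage_flowP[eQ <-] := re.
  rewrite linkage_flow_link // /link.
  case se: (linkage_flow s) => [f|].
    by have /linkage_flowP[fQ <-] := se; move=> /linkage_tail_inj ->.
  move=> es; have [||f fQ hf] := @linkage_edges_pred e => //.
    by move: si; rewrite es inE.
  by have := linkage_flow_head fQ; rewrite hf es se.
move=> r s ri si e.
case re: (linkage_flow r) => [a|]; first exact: main re e.
case se: (linkage_flow s) => [a|]; first exact/esym/(main s r a).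
by move: e; rewrite /link re se.
Qed.

(** An unvisited vertex of nonzero class is matched with itself, hence not free. So a used edge
    enters [v], and it is the last of its path, since the head of a successor would be matched with
    [v]. *)
Lemma linkage_flow_end v : v \in free linkage_flow -> cls v != 0 ->
  exists p, [/\ p \in Q, path_end p = Some v, linked_path (cls v) p & 0 < cls v <= 3].
Proof.
move=> vf vc; have vi : v \in inner by rewrite inE.
have := link_notin_free linkage_flow vi; rewrite /link.
case vE: (linkage_flow v) => [e|]; last by rewrite vf.
move=> _; have /linkage_flowP[/linkage_edgesP[p pQ ep] hv] := vE.
case: (linkage_edges_succ pQ ep) => [[pv pe ce]|[f fQ tf]].
  by exists p; rewrite -hv.
have fi : h f \in inner by rewrite inE cls_head.
by have := link_notin_free linkage_flow fi; rewrite linkage_flow_link // tf hv vf.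
Qed.

Lemma linkage_flow_is_flow : is_flow linkage_flow.
Proof.
split; [by move=> v e /linkage_flowP[] | exact: linkage_flow_inj | ].
move=> v vf; have [->//|vc] := eqVneq (cls v) 0.
by have [p [_ _ _ /andP[]]] := linkage_flow_end vf vc.
Qed.

(** The bijection sends a path to its last vertex. *)
Lemma linkage_flow_count s : 0 < s <= 3 ->
  class_count (free linkage_flow) s = linkage_count Q s.
Proof.
move=> s3; have s0 : s != 0 by case: s s3.
have end_inj : {in [set p in Q | linked_path s p] &,
    injective (fun p : epath => path_end p)}.
  move=> p q; rewrite !inE => /andP[pQ ps] /andP[qQ qs].
  have [v [-> vp _ _]] := linked_path_end pQ ps s3.
  have [v' [-> vq _ _]] := linked_path_end qQ qs s3.
  by case=> vv; apply: (linkage_vertex pQ qQ vp); rewrite vv.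
rewrite /linkage_count -(card_in_imset end_inj) /class_count.
(* [path_end] has values in an option type, so both sets are compared through [Some]. *)
have Some_injective : injective (@Some V) by move=> ? ? [].
rewrite -(card_imset _ Some_injective); congr #|pred_of_set _|; apply/setP => o.
apply/imsetP/imsetP => [[v]|[p]]; rewrite inE => /andP[].
  move=> vf /eqP vs ->; have [|p [pQ pv pl _]] := linkage_flow_end vf.
    by rewrite vs.
  by exists p; rewrite ?pv // inE pQ -vs.
move=> pQ pl ->; have [v [-> _ vs vf]] := linked_path_end pQ pl s3.
by exists v; rewrite // inE vf vs eqxx.
Qed.

(** Each used edge occurs once, and on exactly one path. *)
Lemma linkage_weight (R : realType) (w : E -> \bar R) :
  (\sum_(p in Q) \sum_(e <- bseqval p) w e)%E = (\sum_(e in linkage_edges Q) w e)%E.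
Proof.
transitivity (\sum_(p in Q) \sum_(e | e \in bseqval p) w e)%E.
  apply: eq_bigr => p /Q_linkage.1[s _ /linked_path_uniq up].
  by rewrite big_uniq.
rewrite (exchange_big_dep (mem (linkage_edges Q))) /=; last first.
  by move=> p e pQ ep; apply/linkage_edgesP; exists p.
apply: eq_bigr => e /linkage_edgesP[p pQ ep]; rewrite (big_pred1 p) // => q /=.
apply/andP/eqP => [[qQ eq]|->//].
by apply: (linkage_vertex qQ pQ (tail_vertices eq) (tail_vertices ep)).
Qed.

Lemma linkage_edges_flow e :
  (e \in linkage_edges Q) = (linkage_flow (h e) == Some e).
Proof. by apply/idP/eqP => [/linkage_flow_head|/linkage_flowP[]]. Qed.

End LinkageToFlow.

(** The sum is indexed by vertices so that [swap] merely exchanges summands of two flows, vertex by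
    vertex. *)
Definition flow_weight (R : realType) (w : E -> \bar R) (g : flow_map) : \bar R :=
  (\sum_v if g v is Some e then w e else 0)%E.

Lemma flow_weightE (R : realType) (w : E -> \bar R) (g : flow_map) :
  is_flow g -> flow_weight w g = (\sum_(e | g (h e) == Some e) w e)%E.
Proof.
case=> gh _ _; rewrite (partition_big h predT) //; apply: eq_bigr => v _.
rewrite (eq_bigl (fun e => g v == Some e)) => [|e]; last first.
  apply/andP/eqP => [[/eqP ge /eqP <-//]|ge].
  by have := gh _ _ ge => hv; rewrite hv ge !eqxx.
case: (g v) => [e|]; last by rewrite big_pred0.
by rewrite (big_pred1 e) // => f; apply/eqP/eqP => [[]|->].
Qed.

(** * From flows to disjoint paths *)

Section FlowToLinkage.
Variable g : flow_map.
Hypothesis g_flow : is_flow g.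

Let g_head v e : g v = Some e -> h e = v. Proof. by case: g_flow => + _ _; apply. Qed.
Let g_inj : {in inner &, injective (link g)}. Proof. by case: g_flow. Qed.

Let head_inner e : h e \in inner. Proof. by rewrite inE cls_head. Qed.

(** Follows incoming edges back from [v]. The first argument is fuel; as ranks drop at each step,
    [(rk v).+1] units suffice. *)
Fixpoint trace_rec n v : seq E :=
  if n is n'.+1 then
    if g v is Some e then rcons (trace_rec n' (t e)) e else [::]
  else [::].

Definition trace v := trace_rec (rk v).+1 v.

Lemma trace_rec_indep n m v :
  rk v < n -> rk v < m -> trace_rec n v = trace_rec m v.
Proof.
elim: n m v => // n IH [|m] v //= vn vm.
case ve: (g v) => [e|] //; congr rcons; have := rk_lt e; rewrite (g_head ve) => ev.
by apply: IH; apply: leq_trans ev _.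
Qed.

Lemma traceE v : trace v = if g v is Some e then rcons (trace (t e)) e else [::].
Proof.
rewrite {1}/trace /=; case ve: (g v) => [e|] //; congr rcons.
by apply: trace_rec_indep => //; rewrite -(g_head ve).
Qed.

Definition flow_ends : {set V} := [set v in free g | cls v != 0].

Lemma flow_ends_some v : v \in flow_ends -> exists e, g v = Some e.
Proof.
rewrite inE => /andP[vf vc]; have vi : v \in inner by rewrite inE.
have := link_notin_free g vi; rewrite /link.
by case: (g v) => [e|]; [exists e | rewrite vf].
Qed.

(** An unvisited tail of nonzero class would be linked to itself, just as [v] is linked to it;
    injectivity would identify the two, against their ranks. Hence tracing back stops only in class
    0. *)
Lemma g_tail_some v e : g v = Some e -> cls (t e) != 0 -> exists f, g (t e) = Some f.
Proof.
move=> ve te; have hv := g_head ve; case tf: (g (t e)) => [f|]; first by exists f.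
have : t e = v.
  by apply: g_inj; rewrite ?inE // -?hv ?cls_head // /link tf hv ve.
by have := rk_lt e; rewrite hv => + ev; rewrite ev ltnn.
Qed.

Lemma trace_linked v e : g v = Some e -> linked_path (cls v) (trace v).
Proof.
have [n] := ubnP (rk v); elim: n v e => // n IH v e vn ve.
have hv := g_head ve; rewrite traceE ve.
have [te|te] := eqVneq (cls (t e)) 0.
  have -> : trace (t e) = [::].
    rewrite traceE; case tf: (g (t e)) => [f|] //.
    by move: (cls_head f); rewrite (g_head tf) te.
  by rewrite /= te hv !eqxx.
have [f tf] := g_tail_some ve te; have := IH (t e) f _ tf.
have /[swap] /[apply] : rk (t e) < n.
  by apply: leq_trans (rk_lt e) _; rewrite hv -ltnS.
have : path_end (trace (t e)) = Some (t e).
  by rewrite traceE tf; case: (trace (t f)) => [|a q] /=; rewrite ?last_rcons (g_head tf).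
case: (trace (t e)) => // a q [] la /= /and3P[ca paq _].
by rewrite ca rcons_path paq last_rcons hv eqxx /follows la eqxx.
Qed.

Lemma trace_end v e : g v = Some e -> path_end (trace v) = Some v.
Proof.
move=> ve; rewrite traceE ve.
by case: (trace (t e)) => [|a q] /=; rewrite ?last_rcons (g_head ve).
Qed.

Lemma mem_trace v e : e \in trace v -> g (h e) = Some e.
Proof.
have [n] := ubnP (rk v); elim: n v => // n IH v vn; rewrite traceE.
case vf: (g v) => [f|] //; rewrite mem_rcons inE => /orP[/eqP ->|].
  by rewrite (g_head vf).
by apply: IH; rewrite -ltnS; apply: leq_trans vn; rewrite ltnS -(g_head vf).
Qed.

Lemma trace_closed v e f : f \in trace v -> g (t f) = Some e -> e \in trace v.
Proof.
have [n] := ubnP (rk v); elim: n v => // n IH v vn; rewrite traceE.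
case va: (g v) => [a|] //; rewrite !mem_rcons !inE => /orP[/eqP ->|fa] ge.
  by rewrite traceE ge mem_rcons mem_head orbT.
rewrite IH ?orbT //; rewrite -ltnS; apply: leq_trans vn.
by rewrite ltnS -(g_head va).
Qed.

(** Following the flow forward from [e] raises the rank until a free vertex is reached, whose trace
    contains [e]. The induction is on the gap to the maximal rank. *)
Lemma trace_cover e : g (h e) = Some e -> exists2 v, v \in flow_ends & e \in trace v.
Proof.
have [n] := ubnP (\max_u rk u - rk (h e)); elim: n e => // n IH e en ge.
have [hf|/freePn[u ui]] := boolP (h e \in free g).
  exists (h e); first by rewrite inE hf cls_head.
  by rewrite traceE ge mem_rcons mem_head.
rewrite /link; case uf: (g u) => [f|] eu; last by move: uf; rewrite -eu ge.
have hu := g_head uf.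
have [||v vE fv] := IH f; [|by rewrite hu|by exists v; rewrite // (trace_closed fv) // -eu].
rewrite -ltnS; apply: leq_trans en; rewrite ltnS eu; apply: ltn_sub2l => //.
by apply: leq_trans (rk_lt f) (leq_bigmax _).
Qed.

Lemma trace_link v e : e \in trace v -> link g (h e) = t e.
Proof. by move/mem_trace; rewrite /link => ->. Qed.

Lemma tail_notin_free v e : e \in trace v -> t e \notin free g.
Proof. by move=> ev; rewrite -(trace_link ev) link_notin_free. Qed.

Lemma trace_head_inj v v' e f :
  e \in trace v -> f \in trace v' -> h e = h f -> e = f.
Proof. by move=> /mem_trace eg /mem_trace fg ef; move: eg; rewrite ef fg => -[]. Qed.

Lemma trace_tail_inj v v' e f :
  e \in trace v -> f \in trace v' -> t e = t f -> e = f.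
Proof.
move=> ev fv; rewrite -(trace_link ev) -(trace_link fv) => /g_inj ef.
by apply: trace_head_inj ev fv _; apply: ef.
Qed.

(** From a shared edge both traces go forward along the same edges, since tails determine edges.
    They stop together, since a trace end is free and hence not a tail. *)
Lemma trace_edge_inj v v' e : v \in flow_ends -> v' \in flow_ends ->
  e \in trace v -> e \in trace v' -> v = v'.
Proof.
move=> vE vE'; have [n] := ubnP (\max_u rk u - rk (h e)).
have next u a : u \in flow_ends -> a \in trace u ->
    h a = u \/ exists2 f, f \in trace u & t f = h a.
  move=> /flow_ends_some[b ub]; have := trace_end ub; have := trace_linked ub.
  case: (trace u) => // c q /and3P[_ pcq _] [lu] /(path_succ pcq) [->|]; by [left|right].
have vf u : u \in flow_ends -> u \in free g by rewrite inE => /andP[].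
elim: n e => // n IH e en ev ev'.
case: (next _ _ vE ev) => [hv|[f fv tf]]; case: (next _ _ vE' ev') => [hv'|[f' fv' tf']].
- by rewrite -hv.
- by have := tail_notin_free fv'; rewrite tf' hv vf.
- by have := tail_notin_free fv; rewrite tf hv' vf.
have ff : f' = f by apply: trace_tail_inj fv' fv _; rewrite tf.
rewrite ff in fv'; apply: (IH f) => //; rewrite -ltnS; apply: leq_trans en.
rewrite ltnS -tf; apply: ltn_sub2l => //.
by apply: leq_trans (rk_lt f) (leq_bigmax _).
Qed.

(** A shared vertex, whether head or tail on either trace, yields a shared edge. *)
Lemma trace_vertex_inj v v' u : v \in flow_ends -> v' \in flow_ends ->
  u \in vertices (trace v) -> u \in vertices (trace v') -> v = v'.
Proof.
move=> vE vE' /verticesP[e ev eu] /verticesP[f fv fu].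
have inj := trace_edge_inj vE vE'.
case/orP: eu => /eqP eu; case/orP: fu => /eqP fu; rewrite eu in fu.
- by apply: (inj e) => //; rewrite (trace_tail_inj ev fv fu).
- by apply: (inj f) => //; apply: (trace_closed ev); rewrite fu (mem_trace fv).
- by apply: (inj e) => //; apply: (trace_closed fv); rewrite -fu (mem_trace ev).
- by apply: (inj e) => //; rewrite (trace_head_inj ev fv fu).
Qed.

Definition trace_path v : epath := insub_bseq #|E| (trace v).

Lemma val_trace_path v : v \in flow_ends -> trace_path v = trace v :> seq E.
Proof.
move=> /flow_ends_some[e ve].
by rewrite insubdK //; apply: (linked_path_size (trace_linked ve)).
Qed.

Definition flow_linkage : {set epath} := trace_path @: flow_ends.

Lemma trace_path_linked v : v \in flow_ends -> linked_path (cls v) (trace_path v).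
Proof.
by move=> vE; rewrite val_trace_path //; have [e] := flow_ends_some vE; apply: trace_linked.
Qed.

Lemma trace_path_inj : {in flow_ends &, injective trace_path}.
Proof.
move=> v v' vE vE' vv; have := val_trace_path vE; rewrite vv val_trace_path // => tt.
have [e ve] := flow_ends_some vE;
have ev : e \in trace v by rewrite traceE ve mem_rcons mem_head.
by apply: (trace_edge_inj vE vE' ev); rewrite tt.
Qed.

Lemma flow_linkage_is_linkage : linkage flow_linkage.
Proof.
split=> [p /imsetP[v vE ->]|p q /imsetP[v vE ->] /imsetP[v' vE' ->] vv].
  exists (cls v); last exact: trace_path_linked.
  move: vE; rewrite inE lt0n => /andP[vf ->] /=.
  by case: g_flow => _ _; apply.
rewrite -setI_eq0; apply/eqP/setP => u; rewrite in_setI in_set0.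
rewrite !val_trace_path //; apply: contraNF vv => /andP[uv uv'].
by rewrite (trace_vertex_inj vE vE' uv uv').
Qed.

Lemma flow_linkage_count s : s != 0 ->
  linkage_count flow_linkage s = class_count (free g) s.
Proof.
move=> s0; rewrite /linkage_count /class_count.
rewrite -(@card_in_imset _ _ trace_path [set v in free g | cls v == s]); last first.
  move=> v v'; rewrite 2![_ \in [set _ | _]]inE.
  move=> /andP[vf /eqP vs] /andP[vf' /eqP vs'].
  by apply: trace_path_inj; rewrite inE ?vf ?vf' ?vs ?vs'.
congr #|pred_of_set _|; apply/setP => p; rewrite inE.
apply/andP/imsetP => [[/imsetP[v vE ->] vs]|[v]].
  exists v => //; rewrite inE; move: vE (trace_path_linked vE); rewrite inE => /andP[-> _].
  by move=> /(linked_path_class vs) ->; rewrite eqxx.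
rewrite inE => /andP[vf /eqP vs] ->.
have vE : v \in flow_ends by rewrite inE vf vs.
by rewrite imset_f // -vs trace_path_linked.
Qed.

Lemma flow_linkage_weight (R : realType) (w : E -> \bar R) :
  (\sum_(p in flow_linkage) \sum_(e <- bseqval p) w e)%E = flow_weight w g.
Proof.
rewrite (linkage_weight flow_linkage_is_linkage) (flow_weightE w g_flow).
apply: eq_bigl => e; apply/linkage_edgesP/eqP.
  by case=> p /imsetP[v vE ->]; rewrite val_trace_path // => /mem_trace.
move=> /trace_cover[v vE ev]; exists (trace_path v); first exact: imset_f.
by rewrite val_trace_path.
Qed.

End FlowToLinkage.

(** * Weights, class counts and the exchange for linkages *)

Lemma linkage_flow_weight (R : realType) (w : E -> \bar R) (Q : {set epath}) :
  linkage Q ->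
  flow_weight w (linkage_flow Q) = (\sum_(p in Q) \sum_(e <- bseqval p) w e)%E.
Proof.
move=> QL; rewrite flow_weightE ?linkage_weight //; last exact: linkage_flow_is_flow.
by apply: eq_bigl => e; rewrite linkage_edges_flow.
Qed.

Lemma class_count_sum (A : {set V}) s : class_count A s = \sum_(v in A) (cls v == s).
Proof.
rewrite /class_count -sum1dep_card big_mkcondr; apply: eq_bigr => v _.
by case: eqP.
Qed.

(** Since [link g] is injective on [inner], the number of free vertices is the same for all flows.
    This determines the count of class 0 from the others. *)
Lemma class_count_total g : is_flow g ->
  class_count (free g) 0 + class_count (free g) 1 + class_count (free g) 2 +
  class_count (free g) 3 = #|~: inner|.
Proof.
case=> _ gI g3; rewrite !class_count_sum -!big_split /=.
transitivity #|free g|.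
  rewrite -sum1_card; apply: eq_bigr => v /g3.
  by case: (cls v) => [|[|[|[|]]]].
by rewrite cardsCs setCK (card_in_imset gI) [RHS]cardsCs setCK.
Qed.

Lemma class_count_gt3 g s : is_flow g -> 3 < s -> class_count (free g) s = 0.
Proof.
case=> _ _ g3 s3; apply/eqP; rewrite cards_eq0; apply/eqP/setP => v.
rewrite in_set0 inE; apply/negP => /andP[/g3 + /eqP vs].
by rewrite vs leqNgt s3.
Qed.

Lemma flow_weight_swap (R : realType) (w : E -> \bar R) (D : {set V}) (g f : flow_map) :
  (flow_weight w (swap D g f) + flow_weight w (swap D f g) =
   flow_weight w g + flow_weight w f)%E.
Proof.
rewrite /flow_weight -!big_split /=; apply: eq_bigr => v _; rewrite !ffunE.
by case: ifP => // _; rewrite addeC.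
Qed.

Definition linkage_total (R : realType) (w : E -> \bar R) (Q : {set epath}) : \bar R :=
  (\sum_(p in Q) \sum_(e <- bseqval p) w e)%E.

Lemma linkage_exchange (R : realType) (w : E -> \bar R) (Q1 Q2 : {set epath})
    (A : nat -> nat) (x y z : nat) :
  linkage Q1 -> linkage Q2 -> perm_eq [:: x; y; z] [:: 1; 2; 3] ->
  (forall s : nat, 0 < s <= 3 -> linkage_count Q1 s = A s + (s == x)) ->
  (forall s : nat, 0 < s <= 3 -> linkage_count Q2 s = A s + (s == y) + (s == z)) ->
  exists (Q1' Q2' : {set epath}) (q : nat),
    [/\ linkage Q1' /\ linkage Q2', (q == y) || (q == z),
        forall s : nat, 0 < s <= 3 -> linkage_count Q1' s = A s + (s == q),
        forall s : nat, 0 < s <= 3 ->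
          linkage_count Q2' s + (s == q) = A s + (s == x) + (s == y) + (s == z)
      & (linkage_total w Q1' + linkage_total w Q2' =
         linkage_total w Q1 + linkage_total w Q2)%E].
Proof.
move=> L1 L2 xyz c1 c2.
set g := linkage_flow Q1; set f := linkage_flow Q2.
have gF : is_flow g := linkage_flow_is_flow L1.
have fF : is_flow f := linkage_flow_is_flow L2.
have mem_xyz s : (s \in [:: x; y; z]) = (s \in [:: 1; 2; 3]) by apply: perm_mem.
have xyz3 : [&& 0 < x <= 3, 0 < y <= 3 & 0 < z <= 3].
  by have := mem_xyz x; have := mem_xyz y; have := mem_xyz z; rewrite !inE; lia.
have all4 s : s <= 3 -> [|| s == 0, s == x, s == y | s == z].
  by have := mem_xyz s; rewrite !inE; lia.
have u3 : uniq [:: x; y; z] by rewrite (perm_uniq xyz).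
have u4 : uniq [:: 0; x; y; z].
  by rewrite cons_uniq u3 andbT !inE; lia.
have cg s : 0 < s <= 3 -> class_count (free g) s = A s + (s == x).
  by move=> s3; rewrite linkage_flow_count ?c1.
have cf s : 0 < s <= 3 -> class_count (free f) s = A s + (s == y) + (s == z).
  by move=> s3; rewrite linkage_flow_count ?c2.
have c0 : class_count (free g) 0 = (class_count (free f) 0).+1.
  have := class_count_total fF; rewrite -(class_count_total gF).
  rewrite (cg 1) // (cg 2) // (cg 3) // (cf 1) // (cf 2) // (cf 3) //;
  by move: u3 xyz3; rewrite /= !inE; lia.
(* [A] is constrained only at 1, 2 and 3, whereas the exchange of flows needs a common part for
   every class. *)
pose A' s := if s == 0 then class_count (free f) 0 else if s <= 3 then A s else 0.
have [||D [q [F1 F2 qyz C1 C2]]] := @exchange_classes g f A' x y z gF fF all4 u4.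
- move=> s; rewrite /A'; case: (posnP s) => [->|s0].
    by rewrite c0; lia.
  case: leqP => s3; first by rewrite cg ?s0 // addn0.
  by rewrite class_count_gt3 //; lia.
- move=> s; rewrite /A'; case: (posnP s) => [->|s0].
    by lia.
  case: leqP => s3; first by rewrite cf ?s0.
  by rewrite class_count_gt3 //; lia.
exists (flow_linkage (swap D g f)), (flow_linkage (swap D f g)), q; split=> //.
- by split; apply: flow_linkage_is_linkage.
- move=> s s3; rewrite flow_linkage_count //; last by lia.
  by rewrite C1 /A'; case/andP: s3 => /gtn_eqF -> ->; rewrite addn0.
- move=> s s3; rewrite flow_linkage_count //; last by lia.
  by rewrite C2 /A'; case/andP: s3 => /gtn_eqF -> ->.
rewrite /linkage_total !flow_linkage_weight // flow_weight_swap.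
by rewrite !linkage_flow_weight.
Qed.

Lemma linkage_classes (Q : {set epath}) : linkage Q ->
  Q = [set p in Q | linked_path 1 p] :|: [set p in Q | linked_path 2 p]
      :|: [set p in Q | linked_path 3 p].
Proof.
case=> QL _; apply/setP => p; rewrite !inE -!andb_orr.
have [/QL[[|[|[|[|]]]] // _ ->]|//] := boolP (p \in Q); by rewrite ?orbT.
Qed.

End Linkages.

End Flows.

Import Order.TTheory GRing.Theory Num.Theory.

(** * Concatenated networks *)

Section GradedNetworks.
Variables (R : realType) (n : nat).
Implicit Types N : network n.
Local Open Scope ring_scope.

(** These features of the abscissa survive concatenation: it grows along edges and recognizes
    sources and sinks. *)
Record graded N (W : R) (pos : vertex N -> R) : Prop := Graded {
  graded_gt0 : 0 < W;
  graded_bounds : forall v, 0 <= pos v <= W;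
  graded_lt : forall e, pos (etail e) < pos (ehead e);
  graded_source : forall v, (pos v == 0) = (v \in codom (source N));
  graded_sink : forall v, (pos v == W) = (v \in codom (sink N)) }.

Lemma planar_graded (N : planar_network R n) : graded (width N) (@xpos R n N).
Proof.
split.
- exact: width_gt0.
- exact: xpos_strip.
- exact: left_to_right.
- by move=> v; apply/eqP/codomP => [/sourcesE|] [i iv]; [exists i|apply/sourcesE; exists i].
- by move=> v; apply/eqP/codomP => [/sinksE|] [i iv]; [exists i|apply/sinksE; exists i].
Qed.

Definition concat_pos N1 N2 (W1 : R) (pos1 : vertex N1 -> R) (pos2 : vertex N2 -> R)
    (v : vertex (concat N1 N2)) : R :=
  match v with inl v1 => pos1 v1 | inr v2 => W1 + pos2 (val v2) end.

(* [N] is the part of [N'] lying weakly to the left of abscissa [W]. *)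
Record initial_part N N' (W : R) (pos : vertex N -> R) (pos' : vertex N' -> R)
    (eps : edge N -> edge N') (phi : vertex N -> vertex N') : Prop := InitialPart {
  initial_vertex_inj : injective phi;
  initial_edge_inj : injective eps;
  initial_tail : forall e, etail (eps e) = phi (etail e);
  initial_head : forall e, ehead (eps e) = phi (ehead e);
  initial_pos : forall v, pos' (phi v) = pos v;
  initial_edge : forall e, pos' (ehead e) <= W -> e \in codom eps }.

Lemma initial_part_id N W (pos : vertex N -> R) : initial_part W pos pos id id.
Proof. by split=> // e _; apply: codom_f. Qed.

Lemma initial_part_trans N N' N'' (W W' : R) (pos : vertex N -> R)
    (pos' : vertex N' -> R) (pos'' : vertex N'' -> R) eps phi eps' phi' :
  W <= W' -> initial_part W pos pos' eps phi ->
  initial_part W' pos' pos'' eps' phi' ->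
  initial_part W pos pos'' (eps' \o eps) (phi' \o phi).
Proof.
move=> WW' [vi ei et eh ep ee] [vi' ei' et' eh' ep' ee']; split.
- exact: inj_comp.
- exact: inj_comp.
- by move=> e /=; rewrite et' et.
- by move=> e /=; rewrite eh' eh.
- by move=> v /=; rewrite ep' ep.
move=> e eW; have /codomP[e' ee1] := ee' _ (le_trans eW WW').
move: eW; rewrite ee1 eh' ep' => /ee /codomP[e'' ->].
by apply/codomP; exists e''.
Qed.

(** * Gluing two graded networks *)

Section Concat.
Variables (N1 N2 : network n) (W1 W2 : R).
Variables (pos1 : vertex N1 -> R) (pos2 : vertex N2 -> R).
Hypotheses (gr1 : graded W1 pos1) (gr2 : graded W2 pos2).

Local Notation pos12 := (concat_pos W1 pos1 pos2).

(** The case analysis is an explicit dependent match, because the branches of [inr_vertex] use the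
    proof supplied by [boolP]. *)
Lemma inr_vertexP (P : vertex (concat N1 N2) -> Prop) v :
  (forall vs : v \in codom (source N2), P (inl (sink N1 (iinv vs)))) ->
  (forall vs : v \notin codom (source N2), P (inr (exist _ v vs))) ->
  P (inr_vertex N1 v).
Proof.
move=> Pl Pr; rewrite /inr_vertex.
exact: (match boolP (v \in codom (source N2)) as b in alt_spec _ _ _
        return P (match b with AltTrue vs => inl (sink N1 (iinv vs))
                             | AltFalse vs => inr (exist _ v vs) end)
        with AltTrue vs => Pl vs | AltFalse vs => Pr vs end).
Qed.

(** At a glued vertex the two descriptions agree: a sink of [N1] lies at [W1], a source of [N2] at
    0. *)
Lemma concat_pos_inr v : pos12 (inr_vertex N1 v) = W1 + pos2 v.
Proof.
apply: (@inr_vertexP (fun u => pos12 u = _)) => vs //=.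
have /eqP -> : pos1 (sink N1 (iinv vs)) == W1 by rewrite (graded_sink gr1) codom_f.
by have := graded_source gr2 v; rewrite vs => /eqP ->; rewrite addr0.
Qed.

Lemma graded_concat : graded (W1 + W2) pos12.
Proof.
have W10 := graded_gt0 gr1; have W20 := graded_gt0 gr2.
split.
- exact: addr_gt0.
- case=> [v|v] /=.
    have /andP[-> vW] := graded_bounds gr1 v.
    by rewrite (le_trans vW) // lerDl ltW.
  have /andP[v0 vW] := graded_bounds gr2 (val v).
  by rewrite lerD2l vW addr_ge0 // ltW.
- case=> e /=; first exact: (graded_lt gr1).
  by rewrite !concat_pos_inr ltrD2l; apply: (graded_lt gr2).
- case=> v /=.
    rewrite (graded_source gr1); apply/codomP/codomP => -[i].
      by move=> ->; exists i.
    by case=> ->; exists i.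
  have /andP[v0 _] := graded_bounds gr2 (val v).
  rewrite gt_eqF ?ltr_pwDl //; apply/esym/negbTE/codomP => -[i]; by [].
- move=> v; apply/eqP/codomP; last first.
    case=> i ->; rewrite concat_pos_inr; congr (_ + _); apply/eqP.
    by rewrite (graded_sink gr2) codom_f.
  case: v => v /=.
    have /andP[_ vW] := graded_bounds gr1 v => e; move: vW.
    by rewrite e gerDl leNgt W20.
  move=> /addrI /eqP; rewrite (graded_sink gr2) => /codomP[i vi]; exists i.
  apply: (@inr_vertexP (fun u => inr v = u)) => vs.
    by have := valP v; rewrite /= vi vs.
  by congr inr; apply: val_inj.
Qed.

(** Edges of [N2] end strictly to the right of [W1]. *)
Lemma initial_part_concat :
  initial_part W1 pos1 pos12 inl (@inl_vertex n N1 N2).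
Proof.
split=> // [u v [//]|u v [//]|[e|e]] /=; first by move=> _; apply: codom_f.
rewrite concat_pos_inr gerDl leNgt (le_lt_trans _ (graded_lt gr2 e)) //.
by case/andP: (graded_bounds gr2 (etail e)).
Qed.

End Concat.

(** * Transport of paths from an initial part to the full network *)

Section Lift.
Variables (N N' : network n) (W : R) (pos : vertex N -> R) (pos' : vertex N' -> R).
Variables (eps : edge N -> edge N') (phi : vertex N -> vertex N').
Hypotheses (gr : graded W pos) (ip : initial_part W pos pos' eps phi).
Hypothesis pos'_lt : forall e : edge N', pos' (etail e) < pos' (ehead e).
Variables (cls : vertex N' -> nat) (s : nat) (rk : vertex N' -> nat).
Hypothesis cls_source : forall v, (cls v == 0%N) = (pos' v == 0).
Hypothesis cls_sink : forall v, (cls v == s) = (pos' v == W).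
Hypothesis rk_lt : forall e : edge N', (rk (etail e) < rk (ehead e))%N.

Local Notation lpath := (linked_path (@etail n N') (@ehead n N') cls s).
Local Notation verts := (vertices (@etail n N') (@ehead n N')).

(** As [eps] is injective, the image respects the length bound and the default of [insub_bseq] never
    occurs. *)
Definition lift (p : edge_seq N) : edge_seq N' :=
  insub_bseq #|edge N'| (map eps (bseqval p)).

Lemma val_lift p : bseqval (lift p) = map eps (bseqval p).
Proof.
rewrite /lift insubdK // unfold_in size_map; apply: leq_trans (size_bseq p) _.
exact: leq_card (initial_edge_inj ip).
Qed.

Lemma lift_inj : injective lift.
Proof.
move=> p q pq; apply: val_inj; apply: (inj_map (initial_edge_inj ip)).
by have := val_lift q; rewrite -pq val_lift.
Qed.

Lemma lift_linked p : lpath (lift p) = is_path p.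
Proof.
rewrite /is_path val_lift /linked_path /=; case: (bseqval p) => //= e q.
rewrite cls_source last_map cls_sink (initial_tail ip) (initial_head ip).
rewrite !(initial_pos ip) (graded_source gr) (graded_sink gr).
congr [&& _, _ & _]; rewrite path_map; apply: eq_path => a b /=.
by rewrite /follows (initial_tail ip) (initial_head ip) (inj_eq (initial_vertex_inj ip)).
Qed.

(** Abscissas increase along a path, so if its last head lies within [W], all its heads do. *)
Lemma path_codom e q :
  path (follows (@etail n N') (@ehead n N')) e q -> pos' (ehead (last e q)) <= W ->
  pos' (ehead e) <= W /\ exists q', e :: q = map eps q'.
Proof.
elim: q e => [|e' q IH] e /=.
  move=> _ eW; split=> //; have /codomP[e' ->] := initial_edge ip eW.
  by exists [:: e'].
case/andP=> /eqP ee' pq /(IH _ pq)[e'W [q' ->]].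
have eW : pos' (ehead e) <= W by rewrite ee' (le_trans (ltW (pos'_lt e'))).
by split=> //; have /codomP[f ->] := initial_edge ip eW; exists (f :: q').
Qed.

Lemma lift_surj (q : edge_seq N') : lpath q -> exists p, lift p = q.
Proof.
move=> lq; have [q' eq] : exists q', bseqval q = map eps q'.
  move: lq; rewrite /linked_path; case: (bseqval q) => // e r.
  case/and3P=> _ per; rewrite cls_sink => /eqP lW.
  by have [|_ [q' ->]] := path_codom per; [rewrite lW | exists q'].
(* The absence of repetitions gives the length bound built into [edge_seq N]. *)
have uq : uniq q' by apply: (@map_uniq _ _ eps); rewrite -eq (linked_path_uniq rk_lt lq).
have sq : (size q' <= #|edge N|)%N by rewrite -(card_uniqP uq) max_card.
by exists (Bseq sq); apply: val_inj; rewrite /= val_lift eq.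
Qed.

Lemma vertices_lift p : verts (lift p) = phi @: path_vertices p.
Proof.
rewrite val_lift /path_vertices /vertices big_map.
rewrite -[val p]/(bseqval p); elim: (bseqval p) => [|e q IH].
  by rewrite !big_nil imset0.
rewrite !big_cons IH imsetU /endpoints imsetU1 imset_set1.
by rewrite (initial_tail ip) (initial_head ip).
Qed.

Lemma disjoint_lift p q :
  [disjoint verts (lift p) & verts (lift q)] =
  [disjoint path_vertices p & path_vertices q].
Proof.
rewrite !vertices_lift -!setI_eq0 -imsetI ?imset_eq0 // => u v _ _.
exact: initial_vertex_inj ip _ _.
Qed.

Lemma multipath_lift a (P : {set edge_seq N}) :
  multipath a P <->
  [/\ #|lift @: P| = a, forall q, q \in lift @: P -> lpath q
    & {in lift @: P &, forall p q : edge_seq N',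
         p != q -> [disjoint verts p & verts q]}].
Proof.
rewrite /multipath (card_imset _ lift_inj); split.
  case/and3P=> /eqP -> /forall_inP Pp /forall_inP Pd; split=> //.
    by move=> _ /imsetP[p pP ->]; rewrite lift_linked Pp.
  move=> _ _ /imsetP[p pP ->] /imsetP[q qP ->] pq; rewrite disjoint_lift.
  have /forall_inP /(_ q qP) /implyP := Pd _ pP; apply.
  by apply: contra pq => /eqP ->.
case=> -> Zl Zd; rewrite eqxx /=; apply/andP; split.
  by apply/forall_inP => p pP; rewrite -lift_linked Zl // imset_f.
apply/forall_inP => p pP; apply/forall_inP => q qP; apply/implyP => pq.
by rewrite -disjoint_lift Zd ?imset_f // (inj_eq lift_inj).
Qed.

Lemma multipath_vertices_lift (P : {set edge_seq N}) :
  phi @: multipath_vertices P = \bigcup_(q in lift @: P) verts q.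
Proof.
apply/setP => v; apply/imsetP/bigcupP.
  case=> u /bigcupP[p pP up] ->; exists (lift p); first exact: imset_f.
  by rewrite vertices_lift imset_f.
case=> _ /imsetP[p pP ->]; rewrite vertices_lift => /imsetP[u up ->].
by exists u => //; apply/bigcupP; exists p.
Qed.

Lemma multipath_weight_lift (w : edge N' -> \bar R) (P : {set edge_seq N}) :
  linkage_total w (lift @: P) = multipath_weight (w \o eps) P.
Proof.
rewrite /linkage_total big_imset /=; last by move=> p q _ _; apply: lift_inj.
by apply: eq_bigr => p _; rewrite val_lift big_map.
Qed.

Lemma lift_set (Z : {set edge_seq N'}) :
  (forall q, q \in Z -> lpath q) ->
  exists P : {set edge_seq N}, lift @: P = Z.
Proof.
move=> Zl; exists [set p | lift p \in Z]; apply/setP => q.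
apply/imsetP/idP => [[p + ->]|qZ]; first by rewrite inE.
by have [p pq] := lift_surj (Zl _ qZ); exists p; rewrite ?inE pq.
Qed.

End Lift.

(** * Triples of multipaths as linkages of the full network *)

Section Triples.
Variables (N1 N2 N3 : network n) (W1 W2 W3 : R).
Variables (pos1 : vertex N1 -> R) (pos2 : vertex N2 -> R) (pos3 : vertex N3 -> R).
Hypotheses (gr1 : graded W1 pos1) (gr2 : graded W2 pos2) (gr3 : graded W3 pos3).
Variables (w1 : edge N1 -> \bar R) (w2 : edge N2 -> \bar R) (w3 : edge N3 -> \bar R).

Local Notation N12 := (concat N1 N2).
Local Notation N123 := (concat N12 N3).
Local Notation pos12 := (concat_pos W1 pos1 pos2).
Local Notation pos123 := (concat_pos (W1 + W2) pos12 pos3).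
Local Notation w123 := (concat_weight (concat_weight w1 w2) w3).

Let gr12 : graded (W1 + W2) pos12 := graded_concat gr1 gr2.
Let gr123 : graded (W1 + W2 + W3) pos123 := graded_concat gr12 gr3.

Let part12 : initial_part (W1 + W2) pos12 pos123 inl (@inl_vertex n N12 N3) :=
  initial_part_concat gr12 gr3.
Let part1 : initial_part W1 pos1 pos123 (inl \o inl)
  (@inl_vertex n N12 N3 \o @inl_vertex n N1 N2).
Proof.
apply: initial_part_trans (initial_part_concat gr1 gr2) part12.
by rewrite lerDl ltW ?(graded_gt0 gr2).
Qed.
Let part123 := initial_part_id (W1 + W2 + W3) pos123.

Definition abscissas : seq R := [:: 0; W1; W1 + W2; W1 + W2 + W3].

(* The value is 4 at the vertices lying on none of the abscissas. *)
Definition class (v : vertex N123) : nat := index (pos123 v) abscissas.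

(** Turns the real abscissa into the natural-number rank required of linkages. *)
Definition pos_rank (v : vertex N123) : nat := #|[set u | pos123 u < pos123 v]|.

Lemma pos_rank_lt e : (pos_rank (etail e) < pos_rank (ehead e))%N.
Proof.
have lt := graded_lt gr123 e; apply: proper_card; apply/properP; split.
  by apply/subsetP => u; rewrite !inE => /lt_trans; apply.
by exists (etail e); rewrite !inE ?ltxx.
Qed.

(** The widths are positive, so the four abscissas are distinct and [index] inverts [nth]. *)
Lemma class_eq s v : (s <= 3)%N -> (class v == s) = (pos123 v == nth 0 abscissas s).
Proof.
move=> s3; have [w10 w20 w30] := And3 (graded_gt0 gr1) (graded_gt0 gr2) (graded_gt0 gr3).
have ua : uniq abscissas.
  have w12 : 0 < W1 + W2 by apply: addr_gt0.
  rewrite /= !inE !negb_or !(lt_eqF w10) lt_eqF // lt_eqF ?addr_gt0 //.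
  by rewrite !lt_eqF ?ltrDl // -addrA ltrDl addr_gt0.
apply/eqP/eqP => [cs|vs]; last by rewrite /class vs index_uniq.
by rewrite -cs nth_index // -index_mem -[index _ _]/(class v) cs.
Qed.

Local Notation lift1 := (@lift N1 N123 (inl \o inl)).
Local Notation lift2 := (@lift N12 N123 inl).
Local Notation lift3 := (@lift N123 N123 id).
Local Notation lpath := (linked_path (@etail n N123) (@ehead n N123) class).
Local Notation verts := (vertices (@etail n N123) (@ehead n N123)).
Local Notation flinkage := (linkage (@etail n N123) (@ehead n N123) class).
Local Notation fcount := (linkage_count (@etail n N123) (@ehead n N123) class).

Let class_source v : (class v == 0%N) = (pos123 v == 0) := @class_eq 0 v isT.

Lemma class_head (e : edge N123) : class (ehead e) != 0%N.
Proof.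
rewrite class_source gt_eqF // (le_lt_trans _ (graded_lt gr123 e)) //.
by case/andP: (graded_bounds gr123 (etail e)).
Qed.

Lemma disjoint_bigcup (Z Z' : {set edge_seq N123}) :
  reflect (forall p q, p \in Z -> q \in Z' -> [disjoint verts p & verts q])
    [disjoint \bigcup_(p in Z) verts p & \bigcup_(q in Z') verts q].
Proof.
apply: (iffP idP) => [ZZ p q pZ qZ|ZZ].
  have sp := @bigcup_sup _ _ p (mem Z) (fun p => verts p) pZ.
  have sq := @bigcup_sup _ _ q (mem Z') (fun q => verts q) qZ.
  exact: disjointWl sp (disjointWr sq ZZ).
rewrite -setI_eq0; apply/eqP/setP => v; rewrite !inE; apply/negP.
case/andP=> /bigcupP[p pZ vp] /bigcupP[q qZ vq].
by have := disjointFr (ZZ p q pZ qZ) vp; rewrite vq.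
Qed.

(** Paths of different classes are distinct, so disjointness in the union covers both the
    disjointness inside each multipath and that between them. *)
Lemma alpha_multipathE a1 a2 a3 (P1 : {set edge_seq N1})
    (P2 : {set edge_seq N12}) (P3 : {set edge_seq N123})
    (Z1 := lift1 @: P1) (Z2 := lift2 @: P2) (Z3 := lift3 @: P3) :
  @alpha_multipath n N1 N2 N3 a1 a2 a3 (P1, P2, P3) <->
  [/\ flinkage (Z1 :|: Z2 :|: Z3), [/\ #|Z1| = a1, #|Z2| = a2 & #|Z3| = a3]
    & [/\ forall q, q \in Z1 -> lpath 1 q, forall q, q \in Z2 -> lpath 2 q
        & forall q, q \in Z3 -> lpath 3 q]].
Proof.
have M1 := multipath_lift gr1 part1 class_source (fun v => @class_eq 1 v isT) a1 P1.
have M2 := multipath_lift gr12 part12 class_source (fun v => @class_eq 2 v isT) a2 P2.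
have M3 := multipath_lift gr123 part123 class_source (fun v => @class_eq 3 v isT) a3 P3.
have V1 := multipath_vertices_lift part1 P1.
have V2 := multipath_vertices_lift part12 P2.
have V3 := multipath_vertices_lift part123 P3.
rewrite imset_id in V3; rewrite -/Z1 in M1 V1; rewrite -/Z2 in M2 V2; rewrite -/Z3 in M3 V3.
rewrite /alpha_multipath -/(_ \o _) V1 V2 V3; split.
  case/and4P=> /M1[c1 l1 d1] /M2[c2 l2 d2] /M3[c3 l3 d3].
  case/and3P=> /disjoint_bigcup d12 /disjoint_bigcup d13 /disjoint_bigcup d23.
  split=> //; split.
    by move=> q /setUP[/setUP[/l1|/l2]|/l3]; [exists 1%N | exists 2%N | exists 3%N].
  move=> p q /setUP[/setUP[pZ|pZ]|pZ] /setUP[/setUP[qZ|qZ]|qZ] pq;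
    by [apply: d1 | apply: d2 | apply: d3 | apply: d12 | apply: d13 | apply: d23
       | rewrite disjoint_sym; by [apply: d12 | apply: d13 | apply: d23]].
case=> -[_ ZD] [c1 c2 c3] [l1 l2 l3].
have sep s s' (Z Z' : {set edge_seq N123}) : s != s' ->
    Z \subset Z1 :|: Z2 :|: Z3 -> Z' \subset Z1 :|: Z2 :|: Z3 ->
    (forall q, q \in Z -> lpath s q) -> (forall q, q \in Z' -> lpath s' q) ->
    [disjoint \bigcup_(p in Z) verts p & \bigcup_(q in Z') verts q].
  move=> ss ZZ ZZ' l l'; apply/disjoint_bigcup => p q pZ qZ.
  apply: (ZD p q (subsetP ZZ p pZ) (subsetP ZZ' q qZ)).
  apply: contra ss => /eqP pq; apply/eqP.
  by apply: (linked_path_class (l _ pZ)); rewrite pq l'.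
have s1 : Z1 \subset Z1 :|: Z2 :|: Z3 by rewrite -setUA subsetUl.
have s2 : Z2 \subset Z1 :|: Z2 :|: Z3 by rewrite setUAC subsetUr.
have s3 : Z3 \subset Z1 :|: Z2 :|: Z3 by rewrite subsetUr.
apply/and4P; split.
- by apply/M1; split=> // p q /(subsetP s1) pZ /(subsetP s1); apply: ZD.
- by apply/M2; split=> // p q /(subsetP s2) pZ /(subsetP s2); apply: ZD.
- by apply/M3; split=> // p q /(subsetP s3) pZ /(subsetP s3); apply: ZD.
apply/and3P; split.
- exact: (sep 1%N 2%N).
- exact: (sep 1%N 3%N).
- exact: (sep 2%N 3%N).
Qed.

Lemma triple_weight_lift a1 a2 a3 (P1 : {set edge_seq N1})
    (P2 : {set edge_seq N12}) (P3 : {set edge_seq N123}) :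
  @alpha_multipath n N1 N2 N3 a1 a2 a3 (P1, P2, P3) ->
  linkage_total w123 (lift1 @: P1 :|: lift2 @: P2 :|: lift3 @: P3) =
  triple_weight w1 w2 w3 (P1, P2, P3).
Proof.
case/alpha_multipathE=> _ _ [l1 l2 l3].
have dis s s' (Z Z' : {set edge_seq N123}) : s != s' ->
    (forall q, q \in Z -> lpath s q) -> (forall q, q \in Z' -> lpath s' q) ->
    [disjoint Z & Z'].
  move=> ss l l'; rewrite -setI_eq0; apply/eqP/setP => q; rewrite !inE.
  by apply/negP => /andP[/l qs /l' /(linked_path_class qs) /eqP]; apply/negP.
have d12 := dis 1%N 2%N _ _ isT l1 l2; have d13 := dis 1%N 3%N _ _ isT l1 l3.
have d23 := dis 2%N 3%N _ _ isT l2 l3.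
have totalU (Z Z' : {set edge_seq N123}) : [disjoint Z & Z'] ->
    linkage_total w123 (Z :|: Z') = (linkage_total w123 Z + linkage_total w123 Z')%E.
  move=> ZZ'; rewrite /linkage_total -bigU //.
  by apply: eq_bigl => q; rewrite !inE.
rewrite totalU; last by rewrite -setI_eq0 setIUl setU_eq0 !setI_eq0 d13 d23.
rewrite totalU //; congr (_ + _ + _)%E.
- exact: (multipath_weight_lift part1 w123).
- exact: (multipath_weight_lift part12 w123).
- exact: (multipath_weight_lift part123 w123).
Qed.

Lemma linkage_count_lift a1 a2 a3 (P1 : {set edge_seq N1})
    (P2 : {set edge_seq N12}) (P3 : {set edge_seq N123})
    (Q := lift1 @: P1 :|: lift2 @: P2 :|: lift3 @: P3) :
  @alpha_multipath n N1 N2 N3 a1 a2 a3 (P1, P2, P3) ->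
  [/\ fcount Q 1 = a1, fcount Q 2 = a2 & fcount Q 3 = a3].
Proof.
case/alpha_multipathE=> _ [c1 c2 c3] [l1 l2 l3].
have count s (Z : {set edge_seq N123}) : Z \subset Q -> (forall q, q \in Z -> lpath s q) ->
    (forall q, q \in Q -> q \in Z \/ exists2 s', s' != s & lpath s' q) ->
    fcount Q s = #|Z|.
  move=> ZQ l l'; rewrite /linkage_count; congr #|pred_of_set _|; apply/setP => q.
  rewrite inE; apply/andP/idP => [[/l' [//|[s' ss ls']] ls]|qZ]; last by rewrite (subsetP ZQ) ?l.
  by rewrite (linked_path_class ls' ls) eqxx in ss.
split.
- rewrite -c1; apply: count => // [|q /setUP[/setUP[]|]];
  [by rewrite /Q -setUA subsetUl|by left|..].
    by move/l2; right; exists 2%N.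
  by move/l3; right; exists 3%N.
- rewrite -c2; apply: count => // [|q /setUP[/setUP[]|]];
  [by rewrite /Q setUAC subsetUr| |by left|].
    by move/l1; right; exists 1%N.
  by move/l3; right; exists 3%N.
- rewrite -c3; apply: count => // [|q /setUP[/setUP[]|]];
  [by rewrite /Q subsetUr| | |by left].
    by move/l1; right; exists 1%N.
  by move/l2; right; exists 2%N.
Qed.

Lemma max_weight_attained a1 a2 a3 :
  max_weight w1 w2 w3 a1 a2 a3 = -oo%E \/
  exists Q : {set edge_seq N123},
    [/\ flinkage Q, fcount Q 1 = a1, fcount Q 2 = a2, fcount Q 3 = a3
      & linkage_total w123 Q = max_weight w1 w2 w3 a1 a2 a3].
Proof.
(* The alternative passes from two values to their maximum, which is one of them. *)
rewrite /max_weight; elim/big_ind: _ => [|x y IHx IHy|[[P1 P2] P3] aP].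
- by left.
- by rewrite maxEle; case: ifP.
right; exists (lift1 @: P1 :|: lift2 @: P2 :|: lift3 @: P3).
have [c1 c2 c3] := linkage_count_lift aP.
rewrite (triple_weight_lift aP); split=> //.
by case/alpha_multipathE: aP.
Qed.

(** Sorting the paths of [Q] by class and pulling them back to [N1], [N12] and [N123] gives a
    competitor of the same weight. *)
Lemma max_weight_ge (Q : {set edge_seq N123}) : flinkage Q ->
  (linkage_total w123 Q <=
   max_weight w1 w2 w3 (fcount Q 1) (fcount Q 2) (fcount Q 3))%E.
Proof.
move=> QL; have lZ s q : q \in [set p in Q | lpath s p] -> lpath s q.
  by rewrite inE => /andP[].
have [P1 E1] := lift_set part1 (graded_lt gr123)
  (fun v => @class_eq 1 v isT) pos_rank_lt (lZ 1%N).
have [P2 E2] := lift_set part12 (graded_lt gr123)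
  (fun v => @class_eq 2 v isT) pos_rank_lt (lZ 2%N).
have [P3 E3] := lift_set part123 (graded_lt gr123)
  (fun v => @class_eq 3 v isT) pos_rank_lt (lZ 3%N).
have QE := linkage_classes QL.
have aP : @alpha_multipath n N1 N2 N3 (fcount Q 1) (fcount Q 2) (fcount Q 3) (P1, P2, P3).
  apply/alpha_multipathE; rewrite E1 E2 E3 -QE; split=> //.
  by split; apply: lZ.
have := triple_weight_lift aP; rewrite E1 E2 E3 -QE => ->.
by rewrite /max_weight; apply: (@le_bigmax_cond _ _ _ _ (P1, P2, P3)).
Qed.

(** Optimal linkages for the two values on the left are exchanged; the results compete for one of
    the two sums on the right, according to [q]. *)
Lemma max_weight_exchange (A : nat -> nat) (x y z : nat)
    (m := fun c : nat -> nat => max_weight w1 w2 w3 (c 1%N) (c 2%N) (c 3%N))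
    (m1 := fun u => m (fun s => A s + (s == u))%N)
    (m2 := fun u v => m (fun s => A s + (s == u) + (s == v))%N) :
  perm_eq [:: x; y; z] [:: 1%N; 2%N; 3%N] ->
  (m1 x + m2 y z <= maxe (m1 y + m2 x z) (m1 z + m2 x y))%E.
Proof.
move=> xyz; rewrite {1}/m1 {1}/m2 {1 2}/m.
(* If either value is [-oo], so is the sum on the left. *)
have [->|[Q1 [L1 c11 c12 c13 <-]]] := max_weight_attained
  (A 1 + (1 == x))%N (A 2 + (2 == x))%N (A 3 + (3 == x))%N; first by rewrite addNye leNye.
have [->|[Q2 [L2 c21 c22 c23 <-]]] := max_weight_attained
  (A 1 + (1 == y) + (1 == z))%N (A 2 + (2 == y) + (2 == z))%N
  (A 3 + (3 == y) + (3 == z))%N; first by rewrite addeNy leNye.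
have [||Q1' [Q2' [q [[L1' L2'] qyz C1 C2 <-]]]] := linkage_exchange pos_rank_lt
  class_head w123 (A := A) (x := x) (y := y) (z := z) L1 L2 xyz.
- by case=> [|[|[|[|]]]].
- by case=> [|[|[|[|]]]].
have M1 := max_weight_ge L1'; have M2 := max_weight_ge L2'.
rewrite !C1 // in M1; rewrite le_max; apply/orP.
case/orP: qyz => /eqP qE; rewrite qE in C2 M1; [left | right].
- have C2' s : (0 < s <= 3)%N -> fcount Q2' s = (A s + (s == x) + (s == z))%N.
    by move/C2; clear; lia.
  by rewrite !C2' // in M2; apply: leeD.
- have C2' s : (0 < s <= 3)%N -> fcount Q2' s = (A s + (s == x) + (s == y))%N.
    by move/C2; clear; lia.
  by rewrite !C2' // in M2; apply: leeD.
Qed.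

End Triples.

End GradedNetworks.

(** * The tropical tetrahedron equalities *)

Lemma max_attained_twiceP (R : realType) (x y z : \bar R) :
  (x <= maxe y z)%E -> (y <= maxe x z)%E -> (z <= maxe x y)%E ->
  max_attained_twice x y z.
Proof.
(* The larger of [y] and [z] bounds [x], hence is the maximum; its own bound makes it equal to
   another of the three. *)
rewrite /max_attained_twice; case: (leP y z) => [yz xz _|/ltW zy xy + _].
  rewrite le_max (max_idPr xz) => /orP[zx|zy].
    by apply: Or32; split=> //; apply/le_anti/andP.
  by apply: Or33; split=> //; apply/le_anti/andP.
rewrite le_max (max_idPr xy) => /orP[yx|yz].
  by apply: Or31; split=> //; apply/le_anti/andP.
by apply: Or33; split=> //; apply/le_anti/andP.
Qed.

Theorem theorem3p7 (R : realType) (n : nat) (N1 N2 N3 : planar_network R n)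
  (hN1 : has_multipath N1 n) (hN2 : has_multipath N2 n)
  (hN3 : has_multipath N3 n)
  (w1 : edge N1 -> \bar R) (w2 : edge N2 -> \bar R) (w3 : edge N3 -> \bar R)
  (hw1 : weighting w1) (hw2 : weighting w2) (hw3 : weighting w3)
  (i j k : nat) (hijk : (i + j + k + 2 <= n)%N) :
  let m := max_weight w1 w2 w3 in
  max_attained_twice
    (m i j k.+1 + m i.+1 j.+1 k)%E
    (m i j.+1 k + m i.+1 j k.+1)%E
    (m i.+1 j k + m i j.+1 k.+1)%E.
Proof.
(* The leading 0 is padding at class 0; the type is read at 1, 2 and 3 only. *)
have exch := max_weight_exchange (planar_graded N1) (planar_graded N2)
  (planar_graded N3) w1 w2 w3 (fun s => nth 0 [:: 0; i; j; k] s).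
(* One inequality for each of the three sums, the first argument being the class raised alone. *)
have := exch 3 2 1 isT; have := exch 2 1 3 isT; have := exch 1 2 3 isT.
rewrite /= !addn0 !addn1 => E1 E2 E3.
by apply: max_attained_twiceP => //; rewrite maxC.
Qed.
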